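(* Let $\Bbbk$ be algebraically closed and let $X,Y\subset\mathbb{A}^n$ be varieties. Then for $X$ and $Y$ in general position, $\dim(X+Y)=\min\{\dim X+\dim Y,\,n\}$; that is, for general $g\in\mathrm{Aff}_n$, $\dim(gX+Y)=\min\{\dim X+\dim Y,\,n\}$.
   Context: The Minkowski sum $X+Y$ of $X,Y\subset\mathbb{A}^n$ is the Zariski closure of $\{p+q\mid p\in X,q\in Y\}$. $\mathrm{Aff}_n=\mathbb{A}^n\rtimes GL_n$ is the group of affine transformations of $\mathbb{A}^n$; ''for general $g$'' means for all $g$ in a nonempty Zariski open subset. *)

(* Defs.v *)
From HB Require Import structures.
From mathcomp Require Import all_boot all_order all_algebra.
Set Implicit Arguments. Unset Strict Implicit. Unset Printing Implicit Defensive.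
Import GRing.Theory.
Local Open Scope ring_scope.

(* Polynomial functions on a space T with coordinate functions crd:
   the smallest set of functions containing constants and coordinates,
   closed under + and *.  Over an infinite field this is exactly the
   ring of polynomials in the coordinates. *)
Inductive polyfn (k : fieldType) (T I : Type) (crd : I -> T -> k) : (T -> k) -> Prop :=
| pf_const (c : k) : polyfn crd (fun _ => c)
| pf_coord (i : I) : polyfn crd (crd i)
| pf_add f g : polyfn crd f -> polyfn crd g -> polyfn crd (fun x => f x + g x)
| pf_mul f g : polyfn crd f -> polyfn crd g -> polyfn crd (fun x => f x * g x).

Definition zeroset (k : fieldType) (T : Type) (F : (T -> k) -> Prop) (x : T) : Prop :=
  forall f, F f -> f x = 0.

Definition coordA (k : fieldType) (n : nat) (i : 'I_n) (x : 'rV[k]_n) : k := x 0 i.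

Definition zclosed (k : fieldType) (n : nat) (S : 'rV[k]_n -> Prop) : Prop :=
  exists F : ('rV[k]_n -> k) -> Prop,
    (forall f, F f -> polyfn (@coordA k n) f) /\
    (forall x, S x <-> zeroset F x).

Definition zclosure (k : fieldType) (n : nat) (S : 'rV[k]_n -> Prop) (x : 'rV[k]_n) : Prop :=
  forall C, zclosed C -> (forall y, S y -> C y) -> C x.

Definition subsetA (k : fieldType) (n : nat) (A B : 'rV[k]_n -> Prop) : Prop :=
  forall x, A x -> B x.

Definition irred_closed (k : fieldType) (n : nat) (Z : 'rV[k]_n -> Prop) : Prop :=
  zclosed Z /\ (exists x, Z x) /\
  forall Z1 Z2 : 'rV[k]_n -> Prop, zclosed Z1 -> zclosed Z2 ->
    (forall x, Z x -> Z1 x \/ Z2 x) -> subsetA Z Z1 \/ subsetA Z Z2.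

Definition variety (k : fieldType) (n : nat) (X : 'rV[k]_n -> Prop) : Prop :=
  irred_closed X.

Definition is_chain (k : fieldType) (n : nat) (X : 'rV[k]_n -> Prop)
    (c : nat -> 'rV[k]_n -> Prop) (d : nat) : Prop :=
  (forall i, (i <= d)%N -> irred_closed (c i) /\ subsetA (c i) X) /\
  (forall i, (i < d)%N -> subsetA (c i) (c i.+1) /\ exists x, c i.+1 x /\ ~ c i x).

Definition has_dim (k : fieldType) (n : nat) (X : 'rV[k]_n -> Prop) (d : nat) : Prop :=
  (exists c, is_chain X c d) /\ (forall c m, is_chain X c m -> (m <= d)%N).

(* Aff_n: pairs (A, b) with A invertible, acting by x |-> x A + b. *)
Definition aff_act (k : fieldType) (n : nat) (g : 'M[k]_n * 'rV[k]_n) (x : 'rV[k]_n)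
  : 'rV[k]_n := x *m g.1 + g.2.

Definition aff_image (k : fieldType) (n : nat) (g : 'M[k]_n * 'rV[k]_n)
    (X : 'rV[k]_n -> Prop) (z : 'rV[k]_n) : Prop :=
  exists x, X x /\ z = aff_act g x.

Definition mink_sum (k : fieldType) (n : nat) (X Y : 'rV[k]_n -> Prop) : 'rV[k]_n -> Prop :=
  zclosure (fun z => exists p q, X p /\ Y q /\ z = p + q).

Definition coordAff (k : fieldType) (n : nat) (i : ('I_n * 'I_n) + 'I_n)
    (g : 'M[k]_n * 'rV[k]_n) : k :=
  match i with inl ij => g.1 ij.1 ij.2 | inr j => g.2 0 j end.

(* P holds for general g in Aff_n: on a nonempty Zariski open subset of Aff_n,
   i.e. on Aff_n minus the zero set of some family of polynomial functions,
   this complement being nonempty. *)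
Definition general_aff (k : fieldType) (n : nat) (P : 'M[k]_n * 'rV[k]_n -> Prop) : Prop :=
  exists F : ('M[k]_n * 'rV[k]_n -> k) -> Prop,
    (forall f, F f -> polyfn (@coordAff k n) f) /\
    (exists g, g.1 \in unitmx /\ ~ zeroset F g) /\
    (forall g, g.1 \in unitmx -> ~ zeroset F g -> P g).

(* Main.v *)
(* Dimension is computed as the largest number of algebraically independent polynomial
   functions. It strictly increases along irreducible closed sets: adjoin to independent
   functions on the smaller set a function vanishing on it but not on the larger one. Conversely,
   an irreducible closed set with m+1 independent functions u contains a smaller one with m:
   the image of u contains an open set, so a slice u_m = c keeps the remaining functions
   independent, and so does some prime containing the ideal of the slice.

   Upper bound: all coordinates on X x Y are algebraic over dX + dY of them, so multiples of the
   polynomials of degree at most N in the coordinates lie in a space of dimension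
   O(N^(dX + dY)), which leaves no room for dX + dY + 1 independent functions.

   Lower bound: choose transcendence bases among the coordinates of X and of Y. A (singular)
   linear map moving basis coordinates of X to coordinates of Y outside the basis makes
   m = min(dX + dY, n) coordinates of gx + y independent on X x Y. Joining it by a line to an
   arbitrary g shows that these m coordinates together with the entries of g are independent on
   Aff_n x X x Y; hence (g, x, y) |-> (g, gx + y) has an image containing an open set, and every
   g over which this open set is nonempty works. *)
Require Import Defs.
From mathcomp Require Import all_boot all_order all_algebra.
From mathcomp Require Import boolp classical_sets ring zify.
Set Implicit Arguments. Unset Strict Implicit. Unset Printing Implicit Defensive.
Import GRing.Theory.

(** * Prime ideals and the extension of homomorphisms from [R] to [{poly R}] *)

Section Extension.
Local Open Scope ring_scope.

Lemma ex_minimal (A : Type) (f : A -> nat) (P : A -> Prop) :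
  (exists x, P x) -> exists x, P x /\ forall y, P y -> (f x <= f y)%N.
Proof.
move=> [x Px]; have [m] := ubnP (f x); elim: m x Px => // m IHm x Px fx.
have [[y [Py yx]]|no] := pselect (exists y, P y /\ (f y < f x)%N).
  by apply: (IHm y) => //; rewrite (leq_trans yx).
exists x; split=> // y Py; rewrite leqNgt; apply/negP => yx.
by apply: no; exists y.
Qed.

Definition is_ideal (R : comNzRingType) (I : R -> Prop) : Prop :=
  [/\ I 0, forall x y, I x -> I y -> I (x + y) & forall a x, I x -> I (a * x)].

Definition is_prime (R : comNzRingType) (I : R -> Prop) : Prop :=
  [/\ is_ideal I, ~ I 1 & forall x y, I (x * y) -> I x \/ I y].

Section PrimeOps.
Variables (R : comNzRingType) (I : R -> Prop).
Hypothesis idI : is_ideal I.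

Lemma ideal0 : I 0. Proof. by case: idI. Qed.
Lemma idealD x y : I x -> I y -> I (x + y). Proof. by case: idI => _ + _; apply. Qed.
Lemma idealM a x : I x -> I (a * x). Proof. by case: idI => _ _; apply. Qed.
Lemma idealN x : I x -> I (- x). Proof. by rewrite -mulN1r; apply: idealM. Qed.
Lemma idealB x y : I x -> I y -> I (x - y).
Proof. by move=> Ix Iy; apply: idealD => //; apply: idealN. Qed.
Lemma ideal_sum (J : Type) (r : seq J) (P : pred J) (F : J -> R) :
  (forall i, P i -> I (F i)) -> I (\sum_(i <- r | P i) F i).
Proof. by move=> IF; apply: big_ind => //; [apply: ideal0|apply: idealD]. Qed.
End PrimeOps.

Lemma prime_ideal (R : comNzRingType) (I : R -> Prop) : is_prime I -> is_ideal I.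
Proof. by case. Qed.

Lemma primeM (R : comNzRingType) (I : R -> Prop) x y :
  is_prime I -> ~ I x -> ~ I y -> ~ I (x * y).
Proof. by case=> _ _ pI nx ny /pI []. Qed.

Lemma primeX (R : comNzRingType) (I : R -> Prop) x n :
  is_prime I -> ~ I x -> ~ I (x ^+ n).
Proof.
move=> pI nx; elim: n => [|n IHn]; first by rewrite expr0; case: pI.
by rewrite exprS; apply: primeM.
Qed.

Lemma prime_polyC (R : comNzRingType) (I : {poly R} -> Prop) :
  is_prime I -> is_prime (fun c => I c%:P).
Proof.
move=> [[I0 ID IM] I1 pI]; split; [split|by rewrite polyC1|].
- by rewrite polyC0.
- by move=> x y Ix Iy; rewrite polyCD; apply: ID.
- by move=> x y Iy; rewrite polyCM; apply: IM.
by move=> x y; rewrite polyCM; apply: pI.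
Qed.

Lemma ideal_coefs (R : comNzRingType) (I : {poly R} -> Prop) (Q : {poly R}) :
  is_ideal I -> (forall i, I (Q`_i)%:P) -> I Q.
Proof.
move=> idI IQ; rewrite -[Q]coefK poly_def; apply: ideal_sum => // i _.
by rewrite -mul_polyC mulrC; apply: (idealM idI).
Qed.

(** While the leading coefficient lies in [I], removing the leading term keeps the class modulo [I]
    and lowers the size; a coefficient outside [I] stops the descent. *)
Lemma strip_lead (R : comNzRingType) (I : {poly R} -> Prop) (Q : {poly R}) :
  is_ideal I -> ~ (forall i, I (Q`_i)%:P) ->
  exists Q', [/\ I (Q - Q'), (size Q' <= size Q)%N & ~ I (lead_coef Q')%:P].
Proof.
move=> idI; have [m] := ubnP (size Q); elim: m Q => // m IHm Q szQ nQ.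
have [Il|nl] := pselect (I (lead_coef Q)%:P); last first.
  by exists Q; split=> //; rewrite subrr; exact: (ideal0 idI).
have Q0 : Q != 0.
  by apply/eqP => Q0; apply: nQ => i; rewrite Q0 coef0; exact: (ideal0 idI).
set L := (lead_coef Q)%:P * 'X^((size Q).-1).
have IL : I L by rewrite /L mulrC; apply: (idealM idI).
have cL i : L`_i = if i == (size Q).-1 then lead_coef Q else 0.
  by rewrite coefCM coefXn; case: eqP; rewrite (mulr1, mulr0).
have szQL : (size (Q - L)%R < size Q)%N.
  rewrite -[X in (_ < X)%N]prednK ?size_poly_gt0 // ltnS; apply/leq_sizeP => j szj.
  rewrite coefB cL; case: eqP => [->|/eqP ne]; first by rewrite subrr.
  rewrite subr0 nth_default //; move: szj ne.
  by case: (size Q) (Q0) => // s _ /= sj ne; rewrite ltn_neqAle eq_sym ne.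
have [] := IHm (Q - L).
- by rewrite -ltnS (leq_trans _ szQ) // ltnS.
- move=> IQL; apply: nQ => i; have := IQL i.
  rewrite coefB cL; case: eqP => [-> _|_]; first exact: Il.
  by rewrite subr0.
move=> Q' [IQ' szQ' nQ']; exists Q'; split=> //; last exact: leq_trans szQ' (ltnW _).
have -> : Q - Q' = (Q - L - Q') + L by rewrite addrAC subrK.
exact: (idealD idI).
Qed.

Lemma ideal_eqmod (R : comNzRingType) (I : R -> Prop) x y :
  is_ideal I -> I (x - y) -> I y -> I x.
Proof. by move=> idI Ixy Iy; rewrite -(subrK y x); apply: (idealD idI). Qed.

Lemma ideal_eqmod' (R : comNzRingType) (I : R -> Prop) x y :
  is_ideal I -> I (x - y) -> I x -> I y.
Proof. by move=> idI Ixy Ix; rewrite -[y](subKr x); apply: (idealB idI). Qed.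

(* If no element of I has a coefficient outside I, then x is transcendental and xi is chosen
   freely. Otherwise P, of least size in I with leading coefficient outside I, plays the role of
   a minimal polynomial of x, and xi is a root of its image; a nonzero multiple of b modulo I of
   least degree is then a constant, by pseudo-division of P. *)
Lemma extend_hom (k : closedFieldType) (R : idomainType) (I : {poly R} -> Prop) (b : {poly R}) :
  is_prime I -> ~ I b ->
  exists a : R, ~ I a%:P /\ forall phi : {rmorphism R -> k},
    (forall c, I c%:P -> phi c = 0) -> phi a != 0 ->
    exists xi : k, (forall Q, I Q -> (map_poly phi Q).[xi] = 0) /\ (map_poly phi b).[xi] != 0.
Proof.
move=> prI nIb; have idI := prime_ideal prI.
have [allc|nallc] := pselect (forall Q, I Q -> forall i, I (Q`_i)%:P).
  have [i nbi] : exists i, ~ I (b`_i)%:P.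
    by apply: contrapT => no; apply: nIb; apply: ideal_coefs => // i;
       apply: contrapT => nbi; apply: no; exists i.
  exists b`_i; split=> // phi phi0 phib.
  have bn0 : map_poly phi b != 0.
    by apply: contraNneq phib => b0; rewrite -coef_map b0 coef0.
  have [xi nr] := closed_nonrootP _ bn0; exists xi; split=> // Q IQ.
  suff -> : map_poly phi Q = 0 by rewrite horner0.
  by apply/polyP => j; rewrite coef_map coef0; apply: phi0; apply: allc.
have [P [[IP nlP] minP]] : exists P, (I P /\ ~ I (lead_coef P)%:P) /\
    forall Q, I Q /\ ~ I (lead_coef Q)%:P -> (size P <= size Q)%N.
  apply: (ex_minimal (fun P : {poly R} => size P)); apply: contrapT => no; apply: nallc => Q IQ.
  apply: contrapT => /strip_lead [//|Q' [IQQ' _ nlQ']].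
  by apply: no; exists Q'; split=> //; apply: (ideal_eqmod' idI _ IQ).
have smallI Q : I Q -> (size Q < size P)%N -> forall i, I (Q`_i)%:P.
  move=> IQ szQ; apply: contrapT => /strip_lead [//|Q' [IQQ' szQ' nlQ']].
  have : (size P <= size Q')%N by apply: minP; split=> //; apply: (ideal_eqmod' idI _ IQ).
  by rewrite leqNgt (leq_ltn_trans szQ').
have P0 : P != 0.
  by apply/eqP => P0; apply: nlP; rewrite P0 lead_coef0; exact: (ideal0 idI).
have szP : (1 < size P)%N.
  rewrite ltnNge; apply/negP => /size1_polyC Pc.
  by apply: nlP; rewrite Pc lead_coefC -Pc.
(* [J] collects the polynomials outside [I] that are congruent modulo [I] to a multiple of [b]. *)
pose J (Q : {poly R}) := ~ I Q /\ exists V, I (Q - V * b).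
have JI Q Q' : I (Q - Q') -> J Q -> J Q'.
  move=> IQ [nQ [V IV]]; split; first by move=> IQ'; apply: nQ; apply: (ideal_eqmod idI _ IQ').
  exists V; have -> : Q' - V * b = (Q - V * b) - (Q - Q').
    by ring.
  exact: (idealB idI).
have JnI Q : J Q -> ~ (forall i, I (Q`_i)%:P) by move=> [nQ _] /(ideal_coefs idI).
have Jstrip Q : J Q -> exists Q', [/\ J Q', (size Q' <= size Q)%N & ~ I (lead_coef Q')%:P].
  move=> JQ; have [Q' [IQQ' szQ' nlQ']] := strip_lead idI (JnI _ JQ).
  by exists Q'; split=> //; apply: JI JQ.
have Jb : J b by split=> //; exists 1; rewrite mul1r subrr; exact: (ideal0 idI).
have [Q [[JQ nlQ] minQ]] : exists Q, (J Q /\ ~ I (lead_coef Q)%:P) /\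
    forall Q', J Q' /\ ~ I (lead_coef Q')%:P -> (size Q <= size Q')%N.
  apply: (ex_minimal (fun P : {poly R} => size P)).
  by have [Q' [JQ' _ nl]] := Jstrip _ Jb; exists Q'.
have minJ Q' : J Q' -> (size Q <= size Q')%N.
  by move=> /Jstrip [Q'' [JQ'' sz nl]]; apply: leq_trans sz; apply: minQ.
have Q0 : Q != 0.
  by apply/eqP => Q0; apply: nlQ; rewrite Q0 lead_coef0; exact: (ideal0 idI).
have szQP : (size Q < size P)%N.
  have szm : (size (b %% P)%R < size P)%N by rewrite Pdiv.Idomain.ltn_modp.
  apply: leq_ltn_trans szm; apply: minJ.
  have E := Pdiv.Idomain.divp_eq b P; rewrite -mul_polyC polyC_exp in E.
  have Em : (lead_coef P)%:P ^+ scalp b P * b - b %% P = b %/ P * P.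
    by rewrite E addrK.
  have Im : I ((lead_coef P)%:P ^+ scalp b P * b - b %% P).
    by rewrite Em; apply: (idealM idI).
  apply: JI Im _; split; first by apply: primeM => //; apply: primeX.
  by exists ((lead_coef P)%:P ^+ scalp b P); rewrite subrr; exact: (ideal0 idI).
(* Otherwise pseudo-divide [P] by [Q]. The remainder is a multiple of [b] modulo [I] shorter than
   [Q], hence in [I]; so [W * Q] and then [W] lie in [I]. But [W] is shorter than [P] and has its
   leading coefficient outside [I], against the choice of [P]. *)
have szQ1 : (size Q <= 1)%N.
  rewrite leqNgt; apply/negP => szQ.
  have E := Pdiv.Idomain.divp_eq P Q; set W := P %/ Q in E.
  have szr : (size (P %% Q)%R < size Q)%N by rewrite Pdiv.Idomain.ltn_modp.
  have [Ir|nIr] := pselect (I (P %% Q)); last first.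
    suff : (size Q <= size (P %% Q)%R)%N by rewrite leqNgt szr.
    apply: minJ; split=> //; case: JQ => _ [V IV]; exists (- (W * V)).
    have -> : P %% Q - - (W * V) * b = lead_coef Q ^+ scalp P Q *: P - W * (Q - V * b).
      by rewrite E; ring.
    by rewrite -mul_polyC; apply: (idealB idI); apply: (idealM idI).
  have IW : I W.
    have : I (W * Q).
      have -> : W * Q = (lead_coef Q ^+ scalp P Q)%:P * P - P %% Q.
        by rewrite mul_polyC E addrK.
      by apply: (idealB idI) => //; apply: (idealM idI).
    by case: prI => _ _ pI /pI [//|]; case: JQ.
  have W0 : W != 0.
    apply: contraTneq szQP => W0; move: E; rewrite W0 mul0r add0r => E.
    rewrite -leqNgt -(@size_scale _ (lead_coef Q ^+ scalp P Q)) ?E; last first.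
      by rewrite expf_neq0 // lead_coef_eq0.
    exact: ltnW.
  have szWQ : (size (P %% Q)%R < size (W * Q)%R)%N.
    by rewrite size_mul // (leq_trans szr) // -subn1 -addnBAC ?size_poly_gt0 // leq_addl.
  have lW : ~ I (lead_coef W)%:P.
    move=> IlW; have : I ((lead_coef Q)%:P ^+ scalp P Q * (lead_coef P)%:P).
      have := congr1 lead_coef E; rewrite lead_coefZ lead_coefDl // lead_coefM => E'.
      by rewrite -polyC_exp -polyCM E' mulrC polyCM; apply: (idealM idI).
    by apply: primeM => //; apply: primeX.
  have szW : (size W < size P)%N.
    rewrite Pdiv.Idomain.size_divp // ltn_subrL -subn1 subn_gt0 szQ.
    exact: ltn_trans szP.
  have : (size P <= size W)%N by apply: minP.
  by rewrite leqNgt szW.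
have Qc := size1_polyC szQ1; set c := Q`_0 in Qc.
(* The factor [lead_coef P] preserves the degree of [P] under [phi], so a root exists; the factor
   [c], a multiple of [b] modulo [I], keeps [b] from vanishing at that root. *)
exists (lead_coef P * c); split.
  by rewrite polyCM; apply: primeM => //; rewrite -Qc; case: JQ.
move=> phi phi0; rewrite rmorphM mulf_eq0 negb_or => /andP [phil phic].
have szPphi : size (map_poly phi P) = size P by apply: size_map_poly_id0.
have [|xi /eqP rxi] := closed_rootP (map_poly phi P) _.
  by rewrite szPphi; case: (size P) szP => [|[|]].
(* Pseudo-division by [P] leaves a remainder in [I] shorter than [P]; by [smallI] its coefficients
   lie in [I], so [phi] kills them. *)
have vanI Q' : I Q' -> (map_poly phi Q').[xi] = 0.
  move=> IQ'; have E := Pdiv.Idomain.divp_eq Q' P.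
  have Ir : I (Q' %% P).
    have -> : Q' %% P = (lead_coef P ^+ scalp Q' P)%:P * Q' - Q' %/ P * P.
      by rewrite mul_polyC E addrAC subrr add0r.
    by apply: (idealB idI) => //; apply: (idealM idI).
  have szr : (size (Q' %% P)%R < size P)%N by rewrite Pdiv.Idomain.ltn_modp.
  have r0 : map_poly phi (Q' %% P) = 0.
    by apply/polyP => i; rewrite coef_map coef0; apply: phi0; apply: smallI.
  have := congr1 (fun q => (map_poly phi q).[xi]) E.
  rewrite -mul_polyC !(rmorphD, rmorphM) /= r0 addr0 !hornerM rxi mulr0 map_polyC hornerC.
  by move/eqP; rewrite mulf_eq0 /= rmorphXn /= expf_eq0 (negbTE phil) andbF => /eqP.
exists xi; split=> //.
case: JQ => _ [V /vanI]; rewrite Qc rmorphB rmorphM /= map_polyC hornerD hornerN hornerM hornerC.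
move/eqP; rewrite subr_eq0 => /eqP E; move: phic; rewrite /= E mulf_eq0 negb_or.
by case/andP.
Qed.
End Extension.

(** * Iterated polynomial rings, their points and their primes *)

Section IteratedPolynomials.
Local Open Scope ring_scope.

(** The last variable is the outermost one, so univariate results apply directly in an induction on
    the number of variables. *)
Fixpoint itp (k : fieldType) (m : nat) : idomainType :=
  if m is m'.+1 then {poly (itp k m')} else k.

(* Points are sequences; only the first m entries matter for [itp k m]. *)
Fixpoint ev (k : fieldType) (m : nat) (a : nat -> k) : {rmorphism itp k m -> k} :=
  match m with
  | 0 => idfun
  | m'.+1 => horner_eval (a m') \o map_poly (@ev k m' a)
  end.

Lemma evS (k : fieldType) (m : nat) (a : nat -> k) (p : {poly itp k m}) :
  ev m.+1 a p = (map_poly (ev m a) p).[a m].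
Proof. by []. Qed.

Lemma eq_ev (k : fieldType) (m : nat) (a b : nat -> k) :
  (forall i, (i < m)%N -> a i = b i) -> ev m a =1 ev m b.
Proof.
elim: m => [//|m IHm] ab p; rewrite !evS ab //; congr horner.
by apply: eq_map_poly => c; apply: IHm => i im; apply: ab; apply: ltnW.
Qed.

Definition upd (k : Type) (a : nat -> k) (m : nat) (x : k) (i : nat) : k :=
  if i == m then x else a i.

Lemma ev_upd (k : fieldType) (m : nat) (a : nat -> k) (x : k) p :
  ev m (upd a m x) p = ev m a p.
Proof. by apply: eq_ev => i im; rewrite /upd ltn_eqF. Qed.

Lemma evS_upd (k : fieldType) (m : nat) (a : nat -> k) (x : k) (p : {poly itp k m}) :
  ev m.+1 (upd a m x) p = (map_poly (ev m a) p).[x].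
Proof.
rewrite evS {2}/upd eqxx; congr horner; apply: eq_map_poly => c; exact: ev_upd.
Qed.

Lemma evC (k : fieldType) (m : nat) (a : nat -> k) (c : itp k m) :
  ev m.+1 a c%:P = ev m a c.
Proof. by rewrite evS map_polyC hornerC. Qed.

Lemma evX (k : fieldType) (m : nat) (a : nat -> k) : ev m.+1 a 'X = a m.
Proof. by rewrite evS map_polyX hornerX. Qed.

Lemma evSD (k : fieldType) (m : nat) (a : nat -> k) (p q : {poly itp k m}) :
  ev m.+1 a (p + q) = ev m.+1 a p + ev m.+1 a q.
Proof. by rewrite !evS rmorphD hornerD. Qed.

Lemma evSB (k : fieldType) (m : nat) (a : nat -> k) (p q : {poly itp k m}) :
  ev m.+1 a (p - q) = ev m.+1 a p - ev m.+1 a q.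
Proof. by rewrite !evS rmorphB hornerD hornerN. Qed.

Lemma evSM (k : fieldType) (m : nat) (a : nat -> k) (p q : {poly itp k m}) :
  ev m.+1 a (p * q) = ev m.+1 a p * ev m.+1 a q.
Proof. by rewrite !evS rmorphM hornerM. Qed.

Lemma evSXn (k : fieldType) (m n : nat) (a : nat -> k) : ev m.+1 a 'X^n = a m ^+ n.
Proof. by rewrite evS map_polyXn hornerXn. Qed.

Lemma evS_sum (k : fieldType) (m : nat) (a : nat -> k) (J : finType) (F : J -> {poly itp k m}) :
  ev m.+1 a (\sum_j F j) = \sum_j ev m.+1 a (F j).
Proof. by rewrite evS rmorph_sum horner_sum. Qed.

Lemma ev_const (k : fieldType) (m : nat) (c : k) :
  exists p : itp k m, forall a, ev m a p = c.
Proof.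
elim: m => [|m [p IHp]]; first by exists c.
by exists p%:P => a; rewrite evC.
Qed.

Lemma ev_var (k : fieldType) (m i : nat) :
  (i < m)%N -> exists p : itp k m, forall a, ev m a p = a i.
Proof.
elim: m => [//|m IHm]; rewrite ltnS leq_eqVlt => /orP [/eqP ->|/IHm [p Hp]].
  by exists 'X => a; rewrite evX.
by exists p%:P => a; rewrite evC.
Qed.

(** Choose a point where the leading coefficient is nonzero, then a value of the last variable that
    is not a root. *)
Lemma ev_neq0 (k : closedFieldType) (m : nat) (p : itp k m) :
  p != 0 -> exists a, ev m a p != 0.
Proof.
elim: m p => [|m IHm] p p0; first by exists (fun=> 0).
have [a la] := IHm (lead_coef p) (etrans (congr1 negb (lead_coef_eq0 p)) p0).
have [|x rx] := closed_nonrootP (map_poly (ev m a) p) _.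
  by apply: contraNneq la => E; rewrite lead_coefE -coef_map E coef0.
by exists (upd a m x); rewrite evS_upd.
Qed.

Lemma polyfn_ext (k : fieldType) (T I : Type) (crd : I -> T -> k) f g :
  f =1 g -> polyfn crd f -> polyfn crd g.
Proof. by move=> /funext ->. Qed.

Lemma polyfn_ev (k : fieldType) (T I : Type) (crd : I -> T -> k) (v : nat -> T -> k)
    (m : nat) (p : itp k m) :
  (forall i, (i < m)%N -> polyfn crd (v i)) ->
  polyfn crd (fun t => ev m (v^~ t) p).
Proof.
elim: m p => [|m IHm] p pv; first exact: pf_const.
have pv' i : (i < m)%N -> polyfn crd (v i) by move=> im; apply: pv; apply: ltnW.
elim/poly_ind: p => [|p c IHp].
  by apply: polyfn_ext (pf_const crd 0) => t; rewrite rmorph0.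
apply: polyfn_ext (pf_add (pf_mul IHp (pv m _)) (IHm c pv')) => // t.
by rewrite rmorphD rmorphM evC evX.
Qed.

Lemma ev_polyfn (k : fieldType) (T : Type) (m : nat) (v : nat -> T -> k) (f : T -> k) :
  polyfn (fun i : 'I_m => v i) f -> exists p : itp k m, forall t, f t = ev m (v^~ t) p.
Proof.
elim=> [c|i|g h _ [p Hp] _ [q Hq]|g h _ [p Hp] _ [q Hq]].
- by have [p Hp] := ev_const m c; exists p => t; rewrite Hp.
- by have [p Hp] := ev_var k (ltn_ord i); exists p => t; rewrite Hp.
- by exists (p + q) => t; rewrite rmorphD Hp Hq.
by exists (p * q) => t; rewrite rmorphM Hp Hq.
Qed.

Lemma polyfn_trans (k : fieldType) (T I J : Type) (crd : I -> T -> k) (crd' : J -> T -> k) f :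
  (forall i, polyfn crd' (crd i)) -> polyfn crd f -> polyfn crd' f.
Proof.
move=> cc'; elim=> [c|i|g h _ pg _ ph|g h _ pg _ ph]; [exact: pf_const| |exact: pf_add|].
- exact: cc'.
- exact: pf_mul.
Qed.

Lemma polyfn_comp (k : fieldType) (T S I : Type) (crd : I -> T -> k) (s : S -> T) f :
  polyfn crd f -> polyfn (fun i t => crd i (s t)) (fun t => f (s t)).
Proof.
elim=> [c|i|g h _ pg _ ph|g h _ pg _ ph]; [exact: pf_const| |exact: (pf_add pg ph)|].
- exact: (pf_coord (fun i t => crd i (s t)) i).
- exact: (pf_mul pg ph).
Qed.

Lemma polyfn_sum (k : fieldType) (T I J : Type) (crd : I -> T -> k) (r : seq J)
    (F : J -> T -> k) :
  (forall j, polyfn crd (F j)) -> polyfn crd (fun t => \sum_(j <- r) F j t).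
Proof.
move=> pF; elim: r => [|j r IHr].
  by apply: polyfn_ext (pf_const crd 0) => t; rewrite big_nil.
by apply: polyfn_ext (pf_add (pF j) IHr) => t; rewrite big_cons.
Qed.

Fixpoint lift_itp (k : fieldType) (r j : nat) : itp k j -> itp k (r + j) :=
  if r is r'.+1 then fun c => (@lift_itp k r' j c)%:P else id.

Lemma ev_lift (k : fieldType) (r j : nat) (a : nat -> k) (c : itp k j) :
  ev (r + j) a (lift_itp r c) = ev j a c.
Proof. by elim: r => [//|r IHr]; rewrite -[RHS]IHr; apply: evC. Qed.

(** Apply [extend_hom] to one variable after another: the condition [a1] found for the outermost
    variable is the element to keep nonzero for the contracted prime in one variable fewer. *)
Lemma extend_point (k : closedFieldType) (r j : nat) (I : itp k (r + j) -> Prop)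
    (b : itp k (r + j)) : is_prime I -> ~ I b ->
  exists a : itp k j, ~ I (lift_itp r a) /\ forall p : nat -> k,
    (forall c, I (lift_itp r c) -> ev j p c = 0) -> ev j p a != 0 ->
    exists p', [/\ forall i, (i < j)%N -> p' i = p i,
                   forall Q, I Q -> ev (r + j) p' Q = 0 & ev (r + j) p' b != 0].
Proof.
elim: r I b => [|r IHr] I b prI nIb; first by exists b; split=> // p H pb; exists p.
have [a1 [nIa1 Ha1]] := extend_hom k prI nIb.
have [a [nIa Ha]] := IHr _ a1 (prime_polyC prI) nIa1.
exists a; split=> // p Hp pa; have [p1 [p1p p1I p1a]] := Ha p Hp pa.
have [xi [xiI xib]] := Ha1 (ev (r + j) p1) p1I p1a.
exists (upd p1 (r + j) xi); split.
- by move=> i ij; rewrite /upd ltn_eqF ?(leq_trans ij) ?leq_addl // p1p.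
- by move=> Q IQ; rewrite evS_upd; apply: xiI.
by rewrite evS_upd.
Qed.

(** The Nullstellensatz for a prime ideal: the same descent, carried down to the field, where a
    prime ideal is zero. *)
Lemma prime_has_zero (k : closedFieldType) (m : nat) (I : itp k m -> Prop) (b : itp k m) :
  is_prime I -> ~ I b -> exists p, (forall Q, I Q -> ev m p Q = 0) /\ ev m p b != 0.
Proof.
elim: m I b => [|m IHm] I b prI nIb.
  exists (fun=> 0); split=> /= [Q IQ|]; last first.
    by apply/eqP => b0; apply: nIb; rewrite [b]b0; exact: (ideal0 (prime_ideal prI)).
  apply/eqP/negPn/negP => Q0; case: prI => idI I1 _; apply: I1.
  by rewrite -(mulVf (Q0 : (Q : k) != 0)); apply: (idealM idI).
have [a1 [nIa1 Ha1]] := extend_hom k prI nIb.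
have [p1 [p1I p1a]] := IHm _ a1 (prime_polyC prI) nIa1.
have [xi [xiI xib]] := Ha1 (ev m p1) p1I p1a.
exists (upd p1 m xi); split; last by rewrite evS_upd.
by move=> Q IQ; rewrite evS_upd; apply: xiI.
Qed.

(** An ideal [P] maximal among those that contain [I] and avoid the multiplicative set [S] is prime:
    for [x], [y] outside [P], both [P + (x)] and [P + (y)] meet [S], and the product of the two
    elements would lie in [P] if [x * y] did. *)
Lemma prime_avoiding (R : comNzRingType) (I S : R -> Prop) :
  is_ideal I -> S 1 -> (forall x y, S x -> S y -> S (x * y)) ->
  (forall x, I x -> ~ S x) ->
  exists P, [/\ is_prime P, forall x, I x -> P x & forall x, P x -> ~ S x].
Proof.
move=> idI S1 SM IS.
(* The disjunct [P = set0] accounts for the empty chain in Zorn's lemma. *)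
pose good (P : set R) := (forall x, ~ P x) \/
  [/\ is_ideal P, forall x, I x -> P x & forall x, P x -> ~ S x].
have [F Fgood Ftot|P [gP maxP]] := @Zorn_bigcup R good.
  have [ne|no] := pselect (exists A, F A /\ exists x, A x); last first.
    by left=> x [A FA Ax]; apply: no; exists A; split=> //; exists x.
  right; case: ne => A [FA [x0 Ax0]].
  have Fid B x : F B -> B x -> [/\ is_ideal B, forall x, I x -> B x & forall x, B x -> ~ S x].
    by move=> FB Bx; case: (Fgood _ FB) => // /(_ x).
  have [idA IA _] := Fid _ _ FA Ax0; split.
  - split.
    + by exists A => //; exact: (ideal0 idA).
    + move=> x y [B FB Bx] [C FC Cy]; have [idB _ _] := Fid _ _ FB Bx.
      have [idC _ _] := Fid _ _ FC Cy.
      have [BC|CB] := Ftot _ _ FB FC; first by exists C => //; apply: (idealD idC) => //; apply: BC.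
      by exists B => //; apply: (idealD idB) => //; apply: CB.
    + move=> a x [B FB Bx]; have [idB _ _] := Fid _ _ FB Bx.
      by exists B => //; apply: (idealM idB).
  - by move=> x Ix; exists A => //; apply: IA.
  - by move=> x [B FB Bx]; have [_ _] := Fid _ _ FB Bx; apply.
have max' (B : set R) : good B -> (forall x, P x -> B x) -> forall x, B x -> P x.
  move=> gB PB x Bx; apply: contrapT => nPx; apply: (maxP B) => //.
  by split=> // BP; apply: nPx; apply: BP.
have gI : good I by right.
have [idP IP PS] : [/\ is_ideal P, forall x, I x -> P x & forall x, P x -> ~ S x].
  case: gP => // noP; case: (noP 0); apply: (max' I gI); first by move=> x /noP.
  exact: (ideal0 idI).
exists P; split=> //; split=> //; first by move=> P1; apply: (PS 1).
have meets x : ~ P x -> exists a p, P p /\ S (a * x + p).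
  move=> nPx; apply: contrapT => no; apply: nPx.
  apply: (max' (fun y => exists a p, P p /\ y = a * x + p)); last first.
  - by exists 1, 0; split; [exact: (ideal0 idP)|rewrite mul1r addr0].
  - by move=> y Py; exists 0, y; rewrite mul0r add0r.
  right; split.
  - split.
    + by exists 0, 0; split; [exact: (ideal0 idP)|rewrite mul0r addr0].
    + move=> _ _ [a [p [Pp ->]]] [a' [p' [Pp' ->]]]; exists (a + a'), (p + p').
      by split; [apply: (idealD idP)|ring].
    + move=> c _ [a [p [Pp ->]]]; exists (c * a), (c * p).
      by split; [apply: (idealM idP)|ring].
  - by move=> y Iy; exists 0, y; rewrite mul0r add0r; split=> //; apply: IP.
  - by move=> _ [a [p [Pp ->]]] Sy; apply: no; exists a, p.
move=> x y Pxy; apply: contrapT => /not_orP [nPx nPy].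
have [a [p [Pp Sx]]] := meets _ nPx; have [a' [p' [Pp' Sy]]] := meets _ nPy.
apply: (PS _ _ (SM _ _ Sx Sy)).
have -> : (a * x + p) * (a' * y + p') =
   (a * a') * (x * y) + (a * x + p) * p' + (a' * y) * p by ring.
by apply: (idealD idP); [apply: (idealD idP)|]; apply: (idealM idP).
Qed.

End IteratedPolynomials.

(** * Degree estimates for ring operations *)

Section BoxDegree.
Local Open Scope ring_scope.
Variable k : fieldType.

(* Degree at most N in each variable separately. *)
Fixpoint bdeg (m N : nat) : itp k m -> Prop :=
  match m return itp k m -> Prop with
  | 0 => fun=> True
  | m'.+1 => fun p : {poly itp k m'} => (size p <= N.+1)%N /\ forall j, @bdeg m' N p`_j
  end.

Lemma bdeg_le m N N' (p : itp k m) : (N <= N')%N -> bdeg N p -> bdeg N' p.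
Proof.
elim: m p => [//|m IHm] p NN' [szp cp]; split; first exact: leq_trans szp _.
by move=> j; apply: IHm (cp j).
Qed.

Lemma bdeg0 m N : bdeg N (0 : itp k m).
Proof.
by elim: m => [//|m IHm]; split=> [|j]; [rewrite size_poly0|rewrite coef0].
Qed.

Lemma bdeg1 m N : bdeg N (1 : itp k m).
Proof.
elim: m => [//|m IHm]; split=> [|j]; first by rewrite size_poly1.
by rewrite coef1; case: eqP => _ //; apply: bdeg0.
Qed.

Lemma bdegN m N (p : itp k m) : bdeg N p -> bdeg N (- p).
Proof.
elim: m p => [//|m IHm] p [szp cp]; split=> [|j]; first by rewrite size_polyN.
by rewrite coefN; apply: IHm; apply: cp.
Qed.

Lemma bdegD m N (p q : itp k m) : bdeg N p -> bdeg N q -> bdeg N (p + q).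
Proof.
elim: m p q => [//|m IHm] p q [szp cp] [szq cq]; split=> [|j].
  by rewrite (leq_trans (size_polyD _ _)) // geq_max szp.
by rewrite coefD; apply: IHm; [apply: cp|apply: cq].
Qed.

Lemma bdeg_sum m N (J : Type) (r : seq J) (P : pred J) (F : J -> itp k m) :
  (forall i, P i -> bdeg N (F i)) -> bdeg N (\sum_(i <- r | P i) F i).
Proof. by move=> bF; apply: big_ind => //; [apply: bdeg0|apply: bdegD]. Qed.

Lemma bdegM m N N' (p q : itp k m) : bdeg N p -> bdeg N' q -> bdeg (N + N') (p * q).
Proof.
elim: m p q => [//|m IHm] p q [szp cp] [szq cq]; split=> [|j].
  apply: leq_trans (size_polyMleq p q) _.
  by move: (size p) (size q) szp szq => a b; lia.
by rewrite coefM; apply: bdeg_sum => i _; apply: IHm; [apply: cp|apply: cq].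
Qed.

Lemma bdegX m N e (p : itp k m) : bdeg N p -> bdeg (e * N) (p ^+ e).
Proof.
by move=> bp; elim: e => [|e IHe]; [apply: bdeg1|rewrite exprS mulSn; apply: bdegM].
Qed.

Lemma bdeg_prod m N d (F : 'I_d -> itp k m) :
  (forall i, bdeg N (F i)) -> bdeg (d * N) (\prod_i F i).
Proof.
elim: d F => [|d IHd] F bF; first by rewrite big_ord0; apply: bdeg1.
by rewrite big_ord_recl mulSn; apply: bdegM => //; apply: IHd.
Qed.

Lemma bdeg_ex m (p : itp k m) : exists N, bdeg N p.
Proof.
elim: m p => [|m IHm] p; first by exists 0%N.
have [N HN] : exists N, forall j, bdeg N p`_j.
  elim/poly_ind: p => [|p c [N HN]]; first by exists 0%N => j; rewrite coef0; apply: bdeg0.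
  have [M HM] := IHm c; exists (maxn N M) => -[|j].
    by rewrite coefD coefMX coefC add0r /=; apply: bdeg_le HM; apply: leq_maxr.
  by rewrite coefD coefMX coefC addr0 /=; apply: bdeg_le (HN j); apply: leq_maxl.
exists (maxn (size p) N); split; first by rewrite (leq_trans (leq_maxl _ N)).
by move=> j; apply: bdeg_le (HN j); apply: leq_maxr.
Qed.

End BoxDegree.

Lemma leq_exp_mono (m n e : nat) : (m <= n)%N -> (m ^ e <= n ^ e)%N.
Proof. by case: e => [//|e] mn; rewrite leq_exp2r. Qed.

(** * Growth of spaces of polynomial functions, and algebraic dependence *)

Section Growth.
Local Open Scope ring_scope.
Variables (k : closedFieldType) (T : Type).
Implicit Types w v : nat -> T -> k.

Definition vanish w (m : nat) (p : itp k m) : Prop := forall t, ev m (w^~ t) p = 0.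

Definition indep (m : nat) w : Prop := forall p : itp k m, vanish w p -> p = 0.

(* [w m] is algebraic over [w 0], ..., [w (m - 1)]. *)
Definition algebraic w (m : nat) : Prop :=
  exists P : {poly itp k m}, vanish w (P : itp k m.+1) /\ ~ (forall i, vanish w P`_i).

(** A quantitative form of transcendence degree at most [s] for the first [m] functions: up to the
    common denominator [h], which may vary with [N], those of degree at most [N] lie in a span of
    O(N^s) functions. *)
Definition growth w (s m : nat) : Prop :=
  exists C, forall N, exists (E : finType) (e : E -> T -> k) (h : itp k m),
    [/\ (#|E| <= C * N.+1 ^ s)%N, ~ vanish w h &
        forall f : itp k m, bdeg N f -> exists c : E -> k,
          forall t, ev m (w^~ t) h * ev m (w^~ t) f = \sum_i c i * e i t].

Lemma vanishC w m (c : itp k m) : vanish w (c%:P : itp k m.+1) <-> vanish w c.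
Proof. by split=> H t; have := H t; rewrite evC. Qed.

Lemma ev_wide (m r : nat) (a : nat -> k) (p : {poly itp k m}) : (size p <= r)%N ->
  ev m.+1 a p = \sum_(j < r) ev m a p`_j * a m ^+ j.
Proof.
move=> szp; rewrite evS (@horner_coef_wide _ r) ?(leq_trans (size_poly _ _)) //.
by apply: eq_bigr => j _; rewrite coef_map.
Qed.

Lemma span_poly w m r N (E : finType) (e : E -> T -> k) (h : itp k m) (F : {poly itp k m}) :
  (forall f : itp k m, bdeg N f -> exists c : E -> k,
     forall t, ev m (w^~ t) h * ev m (w^~ t) f = \sum_i c i * e i t) ->
  (size F <= r)%N -> (forall i, bdeg N F`_i) ->
  exists c : E * 'I_r -> k, forall t,
    ev m (w^~ t) h * ev m.+1 (w^~ t) F = \sum_i c i * (e i.1 t * w m t ^+ i.2).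
Proof.
move=> Hh szF bF.
have /choice [c Hc] (i : 'I_r) : exists c : E -> k, forall t,
    ev m (w^~ t) h * ev m (w^~ t) F`_i = \sum_i c i * e i t by apply: Hh.
exists (fun i => c i.2 i.1) => t; rewrite (ev_wide _ szF) mulr_sumr.
rewrite (eq_bigr (fun j : 'I_r => \sum_x c j x * (e x t * w m t ^+ j))); last first.
  by move=> j _; rewrite mulrA Hc mulr_suml; apply: eq_bigr => x _; rewrite mulrA.
by rewrite exchange_big pair_bigA.
Qed.

(** Multiplying the spanning functions by the powers 0, ..., N of the new function costs one factor
    [N.+1]. *)
Lemma growth_any w s m : growth w s m -> growth w s.+1 m.+1.
Proof.
move=> [C HC]; exists C => N; have [E [e [h [cE nh Hh]]]] := HC N.
exists (E * 'I_N.+1)%type, (fun (i : E * 'I_N.+1) t => e i.1 t * w m t ^+ i.2), (h%:P : {poly itp k m}); split.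
- by rewrite card_prod card_ord expnSr mulnA leq_mul2r cE orbT.
- by move/vanishC.
move=> f [szf bf]; have [c Hc] := span_poly Hh szf bf.
by exists c => t; rewrite -Hc evC.
Qed.

(** Modulo the relation [P] of degree r + 1, high powers of the last variable reduce to degree at
    most r once multiplied by powers of the leading coefficient. In the induction, multiplication by
    [l * 'X] produces a term of degree r + 1, which a multiple of [P] cancels; each round adds [e]
    to the degree of the coefficients. *)
Lemma reduce_powers w m (P : {poly itp k m}) r e :
  vanish w (P : itp k m.+1) -> size P = r.+2 -> (forall i, bdeg e P`_i) -> forall j,
  exists c : {poly itp k m}, [/\ (size c <= r.+1)%N, forall i, bdeg (j * e) c`_i &
    vanish w ((lead_coef P ^+ j)%:P * 'X^j - c : itp k m.+1)].
Proof.
move=> vP szP bP; set l := lead_coef P.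
have bl : bdeg e l by apply: bP.
elim=> [|j [c [szc bc vc]]].
  exists 1; split; first by rewrite size_poly1.
    by move=> i; rewrite coef1; case: eqP => _; [apply: bdeg1|apply: bdeg0].
  by move=> t; rewrite !expr0 mulr1 subrr rmorph0.
exists (l%:P * ('X * c) - (c`_r)%:P * P); split.
- apply/leq_sizeP => i ri; rewrite coefB !coefCM coefXM.
  case: i ri => // i ri /=; move: ri; rewrite ltnS leq_eqVlt => /orP [/eqP <-|ri].
    by rewrite /l lead_coefE szP mulrC subrr.
  have -> : c`_i = 0 by apply/nth_default/(leq_trans szc).
  have -> : P`_i.+1 = 0 by apply: nth_default; rewrite szP.
  by rewrite !mulr0 subrr.
- move=> i; rewrite coefB !coefCM coefXM mulSn; apply: bdegD; last first.
    by apply: bdegN; rewrite addnC; apply: bdegM.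
  by apply: bdegM => //; case: eqP => _ //; apply: bdeg0.
move=> t.
have := vc t; have := vP t; rewrite !evSB !evSM !evC !evX !evSXn => -> /eqP.
rewrite subr_eq0 => /eqP <-; rewrite !rmorphXn /= !exprS; ring.
Qed.

(** With the denominator enlarged by [l ^+ N], all powers of [w m] up to N reduce to the powers 0,
    ..., r, so the size of the spanning family grows only by a constant factor. *)
Lemma growth_algebraic w s m : (forall m, is_prime (@vanish w m)) ->
  algebraic w m -> growth w s m -> growth w s m.+1.
Proof.
move=> prw [P0 [vP0 nP0]] [C HC].
have [|P [vPP0 _ nlP]] := strip_lead (prime_ideal (prw m.+1)) (Q := P0).
  by move=> H; apply: nP0 => i; apply/vanishC.
have vP : vanish w (P : itp k m.+1).
  exact: (ideal_eqmod' (prime_ideal (prw m.+1)) vPP0).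
have [r szP] : exists r, size P = r.+2.
  have : (1 < size P)%N.
    rewrite ltnNge; apply/negP => /size1_polyC Pc.
    by apply: nlP; rewrite Pc lead_coefC -Pc.
  by case: (size P) => [|[|r]] // _; exists r.
have [e [_ bP0]] := bdeg_ex (P : itp k m.+1); have bP j : bdeg e P`_j := bP0 j.
set l := lead_coef P in nlP.
have /choice [c Hc] := reduce_powers vP szP bP.
(* Reduction raises the degree of the coefficients from N to at most N + N e, and N + N e + 1 is at
   most (N + 1)(e + 1). *)
exists (C * e.+1 ^ s * r.+1)%N => N; pose N' := (N + N * e)%N.
have [E [b [h [cE nh Hh]]]] := HC N'.
exists (E * 'I_r.+1)%type, (fun (i : E * 'I_r.+1) t => b i.1 t * w m t ^+ i.2).
exists ((h * l ^+ N)%:P : {poly itp k m}); split.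
- rewrite card_prod card_ord mulnAC leq_mul2r /= (leq_trans cE) //.
  by rewrite -mulnA leq_mul2l -expnMn leq_exp_mono ?orbT // /N'; nia.
- move/vanishC; apply: (primeM (prw m)) => //; apply: (primeX (prw m)).
  by move=> vl; apply: nlP; apply/vanishC.
move=> f [szf bf0]; have bf j : bdeg N (f : {poly _})`_j := bf0 j.
(* [F] is [l ^+ N] times [f] with every power of the last variable reduced: [l ^+ j] is used up by
   the reduction of the j-th power. *)
pose F : {poly itp k m} := \sum_(j < N.+1) (f`_j * l ^+ (N - j))%:P * c j.
have szF : (size F <= r.+1)%N.
  apply: (leq_trans (size_sum _ _ _)); apply/bigmax_leqP => j _.
  apply: leq_trans (_ : size (c j) <= _)%N; last by case: (Hc j).
  by rewrite mul_polyC size_scale_leq.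
have bF i : bdeg N' F`_i.
  rewrite coef_sum; apply: bdeg_sum => j _; rewrite coefCM.
  have [_ /(_ i) bcj _] := Hc j.
  have bl : bdeg ((N - j) * e) (l ^+ (N - j)) by apply: bdegX; apply: bP.
  apply: bdeg_le (bdegM (bdegM (bf j) bl) bcj).
  by rewrite /N' -addnA -mulnDl subnK ?leqnn // -ltnS.
have [d Hd] := span_poly Hh szF bF; exists d => t; rewrite -Hd evC rmorphM -mulrA.
congr (_ * _); rewrite (ev_wide _ szf) evS_sum mulr_sumr; apply: eq_bigr => j _.
have [_ _ /(_ t)] := Hc j; rewrite evSB evSM !evC evSXn => /eqP; rewrite subr_eq0 => /eqP E1.
rewrite evSM evC -E1 rmorphM !rmorphXn /=.
have jN : (j <= N)%N by rewrite -ltnS.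
have -> : ev m (w^~ t) l ^+ N = ev m (w^~ t) l ^+ (N - j) * ev m (w^~ t) l ^+ j.
  by rewrite -exprD subnK.
by rewrite /l; ring.
Qed.


Lemma growth0 w : inhabited T -> growth w 0 0.
Proof.
move=> [t0]; exists 1%N => N; exists unit, (fun _ _ => 1), (1 : k); split.
- by rewrite card_unit.
- by move=> /(_ t0) /eqP; rewrite /= oner_eq0.
by move=> f _; exists (fun=> (f : k)) => t; rewrite big_const card_unit /= addr0 mulr1 mul1r.
Qed.

(** Only the functions selected by [tau] raise the exponent; the others are algebraic over their
    predecessors. *)
Lemma growth_count w (tau : pred nat) n : (forall m, is_prime (@vanish w m)) ->
  (forall i, (i < n)%N -> ~~ tau i -> algebraic w i) ->
  growth w (count tau (iota 0 n)) n.
Proof.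
move=> prw; elim: n => [|n IHn] alg.
  apply: growth0; case: (prw 0%N) => _ H _; apply: contrapT => noT.
  by apply: H => t; case: noT; exists.
rewrite -addn1 iotaD count_cat /= add0n addn0 addn1.
have g : growth w (count tau (iota 0 n)) n.
  by apply: IHn => i ni; apply: alg; apply: ltnW.
case: (boolP (tau n)) => tn; first by rewrite addn1; apply: growth_any.
by rewrite addn0; apply: growth_algebraic => //; apply: alg.
Qed.

Lemma digits_sum (K d a : nat) :
  (\sum_(i < d) (a %/ K ^ i %% K) * K ^ i = a %% K ^ d)%N.
Proof.
elim: d => [|d IHd]; first by rewrite big_ord0 expn0 modn1.
rewrite big_ord_recr /= IHd modn_divl -expnS.
have -> : (a %% K ^ d = a %% K ^ d.+1 %% K ^ d)%N.
  by rewrite modn_dvdm // expnS dvdn_mull.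
by rewrite addnC -divn_eq.
Qed.

Lemma left_kernel_neq0 (m n : nat) (A : 'M[k]_(m, n)) : (n < m)%N ->
  exists c : 'rV[k]_m, c != 0 /\ c *m A = 0.
Proof.
move=> nm; have : kermx A != 0.
  rewrite kermx_eq0 /row_free neq_ltn; apply/orP; left.
  by apply: leq_ltn_trans nm; apply: rank_leq_col.
by move/rowV0Pn => [c /sub_kermxP cA c0]; exists c.
Qed.

(** Kronecker substitution: setting the i-th variable to z^(K^i) turns the monomial whose exponents
    are the base K digits of j into z^j. The [c j] become the coefficients of a univariate
    polynomial without a nonzero value. *)
Lemma kronecker_indep (K d : nat) (c : 'I_(K ^ d) -> k) :
  (forall a : nat -> k, \sum_(j < K ^ d) c j * \prod_(i < d) a i ^+ (j %/ K ^ i %% K) = 0) ->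
  forall j, c j = 0.
Proof.
move=> H; pose cn j := if insub j is Some j' then c j' else 0.
pose P := \poly_(j < K ^ d) cn j.
suff P0 : P = 0.
  move=> j; have := congr1 (fun p : {poly k} => p`_j) P0.
  by rewrite coef_poly ltn_ord coef0 /cn valK.
apply/eqP; apply: contraT => /closed_nonrootP [z]; rewrite /root /P horner_poly.
rewrite -[X in X != _]opprK -[X in - X]sub0r -{1}(H (fun i => z ^+ (K ^ i))) => /negP [].
rewrite oppr_eq0 subr_eq0; apply/eqP/eq_bigr => j _; rewrite /cn valK; congr (_ * _).
under eq_bigr do rewrite -exprM mulnC.
by rewrite prodrXr digits_sum modn_small.
Qed.

(* A count of monomials: exponents below K give K^(s+1) monomials in s+1 functions,
   against O(K^s) functions spanning them. *)
Lemma growth_dependent w s n v : (forall m, is_prime (@vanish w m)) -> growth w s n ->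
  (forall i, exists p : itp k n, forall t, v i t = ev n (w^~ t) p) -> ~ indep s.+1 v.
Proof.
move=> prw [C HC] /choice [p Hp] ind.
have [D HD] : exists D, forall i, (i < s.+1)%N -> bdeg D (p i).
  elim: s.+1 => [|s' [D HD]]; first by exists 0%N.
  have [D' HD'] := bdeg_ex (p s'); exists (maxn D D') => i.
  rewrite ltnS leq_eqVlt => /orP [/eqP ->|/HD HDi].
    by apply: bdeg_le HD'; apply: leq_maxr.
  by apply: bdeg_le HDi; apply: leq_maxl.
(* For N = (s + 1) K D, the bound C (N + 1)^s is at most (K - 1) K^s, which is less than the number
   K^(s+1) of monomials. *)
pose K := (C * (s.+1 * D).+1 ^ s).+1.
have [E [e [h [cE nh Hh]]]] := HC (s.+1 * (K * D))%N.
have ltE : (#|E| < K ^ s.+1)%N.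
  apply: (@leq_trans (K.-1 * K ^ s).+1); last first.
    by rewrite expnS -[X in (_ < X * _)%N](@prednK K) // mulSn -addn1 addnC leq_add2r expn_gt0.
  rewrite ltnS (leq_trans cE) // /K /= -mulnA leq_mul2l -expnMn leq_exp_mono ?orbT //.
  by rewrite -/K [(_.+1 * K)%N]mulSn [(K * D)%N]mulnC mulnA -add1n leq_add2r.
pose dg (j i : nat) := (j %/ K ^ i %% K)%N.
pose mono (j : nat) := \prod_(i < s.+1) p i ^+ dg j i.
have bm j : bdeg (s.+1 * (K * D)) (mono j).
  apply: bdeg_prod => i; apply: bdeg_le (bdegX _ (HD i (ltn_ord i))).
  by rewrite leq_mul2r ltnW ?orbT // ltn_mod.
have /choice [c Hc] (j : 'I_(K ^ s.+1)) := Hh _ (bm j).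
(* There are more monomials than spanning functions, so some nontrivial combination [l] of the
   monomials vanishes after multiplication by [h]. [Qn] is that combination in terms of [w], and [q]
   in terms of [v]. *)
have [l [l0 lk]] := left_kernel_neq0 (\matrix_(j, x) c j (enum_val x)) ltE.
have /choice [cn Hcn] (j : 'I_(K ^ s.+1)) := ev_const n (l 0 j).
have /choice [cs Hcs] (j : 'I_(K ^ s.+1)) := ev_const s.+1 (l 0 j).
have /choice [X HX] (i : 'I_s.+1) := ev_var k (ltn_ord i).
pose Qn := \sum_j cn j * mono j.
pose q := \sum_j cs j * \prod_(i < s.+1) X i ^+ dg j i.
have evq a : ev s.+1 a q = \sum_j l 0 j * \prod_(i < s.+1) a i ^+ dg j i.
  rewrite rmorph_sum; apply: eq_bigr => j _; rewrite rmorphM Hcs rmorph_prod.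
  by congr (_ * _); apply: eq_bigr => i _; rewrite rmorphXn HX.
have vQn : vanish w Qn.
  have : vanish w (h * Qn).
    move=> t; rewrite rmorphM rmorph_sum mulr_sumr.
    under eq_bigr do rewrite rmorphM Hcn mulrCA Hc mulr_sumr.
    rewrite exchange_big /= big1 // => x _.
    have := congr1 (fun M : 'rV_ _ => M 0 (enum_rank x)) lk.
    rewrite !mxE => E0; rewrite -[RHS](mul0r (e x t)) -[in RHS]E0 mulr_suml.
    by apply: eq_bigr => j _; rewrite mxE enum_rankK mulrA.
  by case: (prw n) => _ _ pw /pw [].
have q0 : q = 0.
  apply: ind => t; rewrite evq; apply: etrans (vQn t); rewrite rmorph_sum; apply: eq_bigr => j _.
  rewrite rmorphM Hcn rmorph_prod; congr (_ * _); apply: eq_bigr => i _.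
  by rewrite rmorphXn Hp.
move/negP: l0; apply; apply/eqP/rowP => j; rewrite mxE.
by apply: (kronecker_indep (c := fun j => l 0 j)) => a; rewrite -evq q0 rmorph0.
Qed.

(** In a relation among the selected functions, the coefficients with respect to the last one must
    vanish, since that one is not algebraic over its predecessors; these coefficients are relations
    among fewer selected functions. *)
Lemma indep_transcendental w (tau : pred nat) n : inhabited T ->
  (forall i, (i < n)%N -> tau i -> ~ algebraic w i) ->
  indep (count tau (iota 0 n)) (fun l => w (nth 0%N (filter tau (iota 0 n)) l)).
Proof.
move=> [t0]; elim: n => [|n IHn] ntr; first by move=> p /(_ t0).
have {}IHn := IHn (fun i ni => ntr i (ltnW ni)).
rewrite -addn1 iotaD filter_cat count_cat /= add0n addn0.
have szf := size_filter tau (iota 0 n).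
have ltf l : (l < count tau (iota 0 n))%N -> (nth 0%N (filter tau (iota 0 n)) l < n)%N.
  move=> lt; have : nth 0%N (filter tau (iota 0 n)) l \in filter tau (iota 0 n).
    by rewrite mem_nth // szf.
  by rewrite mem_filter mem_iota => /andP [_ /andP []].
case: (boolP (tau n)) => tn; last by rewrite addn0 cats0.
rewrite addn1 => p vp.
set c := count tau (iota 0 n) in p vp *; set f := filter tau (iota 0 n) in IHn vp ltf *.
have /choice [q Hq] (j : nat) : exists q : itp k n, forall t,
    ev n (w^~ t) q = ev c (fun l => w (nth 0%N f l) t) (p : {poly itp k c})`_j.
  have [|q Hq] := @ev_polyfn k T n w (fun t => ev c (fun l => w (nth 0%N f l) t) (p : {poly itp k c})`_j).
    apply: (@polyfn_ev _ _ _ _ (fun l => w (nth 0%N f l))) => l lc.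
    exact: (pf_coord (fun i : 'I_n => w i) (Ordinal (ltf _ lc))).
  by exists q => t; rewrite Hq.
pose Q : {poly itp k n} := \poly_(j < size (p : {poly itp k c})) q j.
have vQ : vanish w (Q : itp k n.+1).
  move=> t; rewrite -(vp t) (@ev_wide _ (size (p : {poly itp k c}))) ?size_poly //.
  rewrite (@ev_wide _ (size (p : {poly itp k c}))) //; apply: eq_bigr => j _.
  rewrite coef_poly ltn_ord Hq nth_cat szf ltnn subnn /=; congr (_ * _).
  by apply: eq_ev => l lc; rewrite nth_cat szf lc.
have cQ j : vanish w Q`_j.
  by apply: contrapT => nj; apply: (ntr n _ tn) => //; exists Q; split=> // /(_ j).
apply/polyP => j; rewrite coef0; apply: IHn => t; rewrite -Hq.
have := cQ j t; rewrite coef_poly; case: ltnP => // szj _.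
by rewrite Hq nth_default // rmorph0.
Qed.

End Growth.

(** * Irreducible parameter spaces and dominant maps *)

Section Parametrized.
Local Open Scope ring_scope.
Variable k : closedFieldType.

(** The polynomial functions on [T] form an integral domain. Stated for any type with coordinates,
    this covers closed sets and their products with each other and with affine spaces alike. *)
Definition irr_param (T I : Type) (crd : I -> T -> k) : Prop :=
  inhabited T /\ forall f g, polyfn crd f -> polyfn crd g ->
    (forall t, f t * g t = 0) -> (forall t, f t = 0) \/ (forall t, g t = 0).

Lemma vanish_prime (T I : Type) (crd : I -> T -> k) (w : nat -> T -> k) :
  irr_param crd -> (forall i, polyfn crd (w i)) -> forall m, is_prime (@vanish k T w m).
Proof.
move=> [[t0] irr] pw m; split; [split| |].
- by move=> t; rewrite rmorph0.
- by move=> p q vp vq t; rewrite rmorphD vp vq addr0.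
- by move=> a p vp t; rewrite rmorphM vp mulr0.
- by move=> /(_ t0) /eqP; rewrite rmorph1 oner_eq0.
move=> p q vpq; apply: (irr (fun t => ev m (w^~ t) p) (fun t => ev m (w^~ t) q)).
- by apply: polyfn_ev => i _.
- by apply: polyfn_ev => i _.
- by move=> t; rewrite -rmorphM.
Qed.

Definition prod_coord (T1 T2 I1 I2 : Type) (crd1 : I1 -> T1 -> k) (crd2 : I2 -> T2 -> k)
    (i : I1 + I2) (t : T1 * T2) : k :=
  match i with inl i => crd1 i t.1 | inr i => crd2 i t.2 end.

(** If [f] is nonzero at (t1, t2) and [g] at (u1, u2), irreducibility of the first factor gives s1
    with f (s1, t2) and g (s1, u2) both nonzero; then use irreducibility of the second factor over
    s1. *)
Lemma irr_prod (T1 T2 I1 I2 : Type) (crd1 : I1 -> T1 -> k) (crd2 : I2 -> T2 -> k) :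
  irr_param crd1 -> irr_param crd2 -> irr_param (prod_coord crd1 crd2).
Proof.
move=> [[t10] irr1] [[t20] irr2]; split; first by exists.
have fix2 f t2 : polyfn (prod_coord crd1 crd2) f -> polyfn crd1 (fun t1 => f (t1, t2)).
  move/(polyfn_comp (fun t1 => (t1, t2))); apply: polyfn_trans => -[i|i].
    exact: (pf_coord crd1 i).
  exact: (pf_const crd1 (crd2 i t2)).
have fix1 f t1 : polyfn (prod_coord crd1 crd2) f -> polyfn crd2 (fun t2 => f (t1, t2)).
  move/(polyfn_comp (fun t2 => (t1, t2))); apply: polyfn_trans => -[i|i].
    exact: (pf_const crd2 (crd1 i t1)).
  exact: (pf_coord crd2 i).
move=> f g pf pg fg; apply: contrapT => /not_orP [nf ng].
have {nf} [[t1 t2] nf] : exists t, f t <> 0.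
  by apply: contrapT => no; apply: nf => t; apply: contrapT => ft; apply: no; exists t.
have {ng} [[u1 u2] ng] : exists t, g t <> 0.
  by apply: contrapT => no; apply: ng => t; apply: contrapT => gt; apply: no; exists t.
have [s1 fgs] : exists s1, f (s1, t2) * g (s1, u2) <> 0.
  apply: contrapT => no.
  have [|/(_ t1)|/(_ u1)] // := irr1 _ _ (fix2 f t2 pf) (fix2 g u2 pg).
  by move=> s1; apply: contrapT => fgs; apply: no; exists s1.
have [|f0|g0] := irr2 _ _ (fix1 f s1 pf) (fix1 g s1 pg); first by move=> t; apply: fg.
  by apply: fgs; rewrite f0 mul0r.
by apply: fgs; rewrite g0 mulr0.
Qed.

Definition npt_coord (m : nat) (i : 'I_m) (a : nat -> k) : k := a i.

Lemma polyfn_npt (m : nat) (f : (nat -> k) -> k) :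
  polyfn (@npt_coord m) f -> exists p : itp k m, forall a, f a = ev m a p.
Proof. exact: (@ev_polyfn k (nat -> k) m (fun i a => a i)). Qed.

Lemma irr_affine (m : nat) : irr_param (@npt_coord m).
Proof.
split; first by exists; exact: (fun=> 0).
move=> f g /polyfn_npt [p Hp] /polyfn_npt [q Hq] fg.
have pq0 : p * q = 0.
  apply/eqP; apply: contraT => /ev_neq0 [a] /eqP [].
  by rewrite rmorphM -Hp -Hq.
move/eqP: pq0; rewrite mulf_eq0 => /orP [/eqP p0|/eqP q0]; [left|right] => a.
  by rewrite Hp p0 rmorph0.
by rewrite Hq q0 rmorph0.
Qed.

Lemma indep_ext (T : Type) (m : nat) (v v' : nat -> T -> k) :
  (forall i t, (i < m)%N -> v i t = v' i t) -> indep m v -> indep m v'.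
Proof.
move=> vv' ind p vp; apply: ind => t; rewrite -(vp t).
by apply: eq_ev => i im; apply: vv'.
Qed.

Lemma indep_leq (T : Type) (m m' : nat) (v : nat -> T -> k) :
  (m <= m')%N -> indep m' v -> indep m v.
Proof.
move/subnK <-; elim: (m' - m)%N => [//|d IHd] ind; apply: IHd => p vp.
apply/eqP; rewrite -polyC_eq0; apply/eqP; apply: ind => t.
by rewrite -[RHS](vp t); apply: evC.
Qed.

(** Write a relation as p h + c. On the image of [s], where [h] vanishes, it reduces to c, so c = 0
    by independence there. As [h] is not identically zero, it cancels from p h = 0, and p is a
    relation of lower degree. *)
Lemma indep_adjoin (T S I : Type) (crd : I -> T -> k) (s : S -> T) (m : nat)
    (v : nat -> T -> k) (h : T -> k) :
  irr_param crd -> (forall i, polyfn crd (v i)) -> polyfn crd h ->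
  indep m (fun i x => v i (s x)) -> (forall x, h (s x) = 0) -> (exists t, h t <> 0) ->
  indep m.+1 (fun i t => if i == m then h t else v i t).
Proof.
move=> [_ irr] pv ph ind hs [t0 ht0] p; set v' := fun i : nat => _.
have ev' t q : ev m (v'^~ t) q = ev m (v^~ t) q.
  by apply: eq_ev => i im; rewrite /v' ltn_eqF.
elim/poly_ind: p => [//|p c IHp] vp.
have Ep t : ev m.+1 (v'^~ t) (p * 'X + c%:P) = ev m.+1 (v'^~ t) p * h t + ev m (v^~ t) c.
  by rewrite evSD evSM evX evC ev' /v' eqxx.
have c0 : c = 0.
  by apply: ind => x; have := vp (s x); rewrite Ep hs mulr0 add0r.
suff -> : p = 0 by rewrite mul0r add0r c0 polyC0.
apply: IHp; have [||| //|h0] := irr (fun t => ev m.+1 (v'^~ t) p) h => //.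
- by apply: polyfn_ev => i _; rewrite /v'; case: eqP.
- by move=> t; have := vp t; rewrite Ep c0 rmorph0 addr0.
Qed.

(* The points (p, xi) lie on the Zariski closure of the image of (v, x), so this says that the
   image of a dominant map contains a nonempty open set. *)
Lemma dominant_open (T I : Type) (crd : I -> T -> k) (m n : nat) (v x : nat -> T -> k) :
  irr_param crd -> (forall i, polyfn crd (v i)) -> (forall i, polyfn crd (x i)) ->
  indep m v ->
  exists a : itp k m, a != 0 /\ forall p, ev m p a != 0 -> exists xi : nat -> k,
    forall F, polyfn (prod_coord (@npt_coord m) (@npt_coord n)) F ->
      (forall t, F (v^~ t, x^~ t) = 0) -> F (p, xi) = 0.
Proof.
(* With [v] listed before [x], independence says that the prime of relations contracts to zero on
   the first [m] variables; so any [p] outside the zeros of [a] extends to a zero of that prime. *)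
move=> irr pv px ind; pose w i := if (i < m)%N then v i else x (i - m)%N.
have pw i : polyfn crd (w i) by rewrite /w; case: ifP.
have prI := vanish_prime irr pw (n + m).
have wv t : ev m (w^~ t) =1 ev m (v^~ t) by apply: eq_ev => i im; rewrite /w im.
have n1 : ~ vanish w (1 : itp k (n + m)) by case: prI.
have [a [nIa Ha]] := extend_point prI n1.
exists a; split.
  by apply: contra_notN nIa => /eqP -> t; rewrite ev_lift rmorph0.
move=> p pa; have [|p' [p'p p'I _]] := Ha p _ pa.
  move=> c vc; suff -> : c = 0 by rewrite rmorph0.
  by apply: ind => t; have := vc t; rewrite ev_lift wv.
exists (fun i => p' (m + i)%N) => F pF vF.
pose s (b : nat -> k) := (b, fun i => b (m + i)%N).
have [|Q HQ] := @polyfn_npt (n + m) (fun b => F (s b)).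
  have := polyfn_comp s pF; apply: polyfn_trans => -[i|i].
    have im : (i < n + m)%N by rewrite ltn_addl.
    exact: (pf_coord (@npt_coord (n + m)) (Ordinal im)).
  have im : (m + i < n + m)%N by rewrite addnC ltn_add2r.
  exact: (pf_coord (@npt_coord (n + m)) (Ordinal im)).
have Feq b b' c c' : (forall i, (i < m)%N -> b i = b' i) -> (forall i, (i < n)%N -> c i = c' i) ->
    F (b, c) = F (b', c').
  move=> bb' cc'; elim: pF => [//|[i|i]|f g _ -> _ ->|f g _ -> _ ->] //.
  - by apply: bb'.
  - by apply: cc'.
have IQ : vanish w Q.
  move=> t; rewrite -HQ -[RHS](vF t); apply: Feq => i im; rewrite /w ?im //.
  by rewrite ltnNge leq_addr /= addKn.
by have := p'I _ IQ; rewrite -HQ => <-; apply: Feq => i im //; rewrite p'p.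
Qed.

End Parametrized.

(** * Dimension as the largest number of independent functions *)

Section Dimension.
Local Open Scope ring_scope.
Variables (k : closedFieldType) (n : nat).
Implicit Types (Z W : 'rV[k]_n -> Prop).

(** The index is a natural number, with value 0 from [n] on, so that the coordinates form a sequence
    as [ev] requires. *)
Definition rc (i : nat) (x : 'rV[k]_n) : k := if insub i is Some j then x 0 j else 0.

Lemma rcE (i : 'I_n) x : rc i x = x 0 i.
Proof. by rewrite /rc valK. Qed.

Lemma polyfn_rc (i : nat) : polyfn (@coordA k n) (rc i).
Proof.
rewrite /rc; case: insubP => [j _ _|_]; first exact: (pf_coord (@coordA k n) j).
exact: pf_const.
Qed.

Lemma polyfnA (f : 'rV[k]_n -> k) :
  polyfn (@coordA k n) f -> exists p : itp k n, forall x, f x = ev n (rc^~ x) p.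
Proof.
move=> pf; apply: (@ev_polyfn k _ n rc); apply: polyfn_trans pf => i.
by apply: polyfn_ext (pf_coord (fun i : 'I_n => rc i) i) => x; rewrite rcE.
Qed.

Lemma polyfn_rc_ev (p : itp k n) : polyfn (@coordA k n) (fun x => ev n (rc^~ x) p).
Proof. by apply: polyfn_ev => i _; apply: polyfn_rc. Qed.

Definition pt_row (a : nat -> k) : 'rV[k]_n := \row_i a i.

Lemma rc_pt_row a (p : itp k n) : ev n (rc^~ (pt_row a)) p = ev n a p.
Proof. by apply: eq_ev => i ni; rewrite (rcE (Ordinal ni)) mxE. Qed.

Lemma polyfn_pt_row (m : nat) f : polyfn (@coordA k n) f ->
  polyfn (prod_coord (@npt_coord k m) (@npt_coord k n)) (fun b => f (pt_row b.2)).
Proof.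
move/(polyfn_comp (fun b : (nat -> k) * (nat -> k) => pt_row b.2)); apply: polyfn_trans => i.
apply: polyfn_ext (pf_coord _ (inr i)) => b.
by rewrite /coordA mxE.
Qed.

Definition pts Z := {x : 'rV[k]_n | Z x}.
Definition crdZ Z (i : 'I_n) (t : pts Z) : k := coordA i (sval t).

Lemma polyfn_restrict Z f : polyfn (@coordA k n) f -> polyfn (@crdZ Z) (fun t => f (sval t)).
Proof. exact: (@polyfn_comp k _ _ _ (@coordA k n) (fun t : pts Z => sval t)). Qed.

Lemma polyfn_lift Z f : polyfn (@crdZ Z) f ->
  exists F, polyfn (@coordA k n) F /\ forall t, f t = F (sval t).
Proof.
elim=> [c|i|g h _ [G [pG HG]] _ [H [pH HH]]|g h _ [G [pG HG]] _ [H [pH HH]]].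
- by exists (fun=> c); split=> //; apply: pf_const.
- by exists (coordA i); split=> //; apply: pf_coord.
- by exists (fun x => G x + H x); split; [apply: pf_add|move=> t; rewrite HG HH].
by exists (fun x => G x * H x); split; [apply: pf_mul|move=> t; rewrite HG HH].
Qed.

Lemma zclosed_zero f : polyfn (@coordA k n) f -> zclosed (fun x => f x = 0).
Proof.
move=> pf; exists (fun g => g = f); split=> [g -> //|x].
by split=> [fx g -> //|]; apply.
Qed.

Lemma irred_param Z : irred_closed Z -> irr_param (@crdZ Z).
Proof.
move=> [_ [[x Zx] irr]]; split; first by exists; exists x.
move=> f g /polyfn_lift [F [pF HF]] /polyfn_lift [G [pG HG]] fg.
have [x' Zx'|HZ|HZ] := irr _ _ (zclosed_zero pF) (zclosed_zero pG).
- have /eqP := fg (exist _ x' Zx'); rewrite HF HG mulf_eq0 /=.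
  by case/orP => /eqP; [left|right].
- by left=> t; rewrite HF; apply: HZ; case: t.
- by right=> t; rewrite HG; apply: HZ; case: t.
Qed.

Lemma param_irred Z : zclosed Z -> irr_param (@crdZ Z) -> irred_closed Z.
Proof.
move=> cZ [[[x Zx]] irr]; split=> //; split; first by exists x.
move=> Z1 Z2 [F1 [pF1 HF1]] [F2 [pF2 HF2]] Z12.
apply: contrapT => /not_orP [n1 n2].
have sep Z' (F : ('rV[k]_n -> k) -> Prop) : (forall x, Z' x <-> zeroset F x) -> ~ subsetA Z Z' ->
    exists f y, [/\ F f, Z y & f y <> 0].
  move=> HF nZ; apply: contrapT => no; apply: nZ => y Zy; apply/HF => f Ff.
  by apply: contrapT => fy; apply: no; exists f, y.
have [f [y [Ff Zy fy]]] := sep _ _ HF1 n1; have [g [z [Gg Zz gz]]] := sep _ _ HF2 n2.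
have [] := irr _ _ (polyfn_restrict Z (pF1 _ Ff)) (polyfn_restrict Z (pF2 _ Gg)).
- move=> [u Zu] /=; have [/HF1 /(_ _ Ff) ->|/HF2 /(_ _ Gg) ->] := Z12 _ Zu.
    by rewrite mul0r.
  by rewrite mulr0.
- by move/(_ (exist _ y Zy)).
- by move/(_ (exist _ z Zz)).
Qed.

Definition has_indep Z (m : nat) : Prop :=
  exists V : nat -> 'rV[k]_n -> k,
    (forall i, polyfn (@coordA k n) (V i)) /\ indep m (fun i (t : pts Z) => V i (sval t)).

Lemma has_indep_leq Z m m' : (m <= m')%N -> has_indep Z m' -> has_indep Z m.
Proof. by move=> mm' [V [pV iV]]; exists V; split=> //; apply: indep_leq iV. Qed.

Lemma has_indep_sub Z W m : subsetA W Z -> has_indep W m -> has_indep Z m.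
Proof.
move=> WZ [V [pV iV]]; exists V; split=> // p vp; apply: iV => -[x Wx].
exact: (vp (exist _ x (WZ x Wx))).
Qed.

Lemma has_indep_lt Z W m : irred_closed W -> irred_closed Z -> subsetA W Z ->
  (exists x, Z x /\ ~ W x) -> has_indep W m -> has_indep Z m.+1.
Proof.
move=> [[F [pF HF]] _] /irred_param irrZ WZ [x [Zx nWx]] [V [pV iV]].
have [h [Fh hx]] : exists h, F h /\ h x <> 0.
  apply: contrapT => no; apply: nWx; apply/HF => h Fh.
  by apply: contrapT => hx; apply: no; exists h.
exists (fun i => if i == m then h else V i); split=> [i|].
  by case: eqP => _ //; apply: pF.
pose s (t : pts W) : pts Z := exist _ (sval t) (WZ _ (svalP t)).
apply: indep_ext (@indep_adjoin k (pts Z) (pts W) _ (@crdZ Z) s m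
  (fun i t => V i (sval t)) (fun t => h (sval t)) irrZ _ _ iV _ _).
- by move=> i t _; case: eqP.
- by move=> i; apply: polyfn_restrict.
- by apply: polyfn_restrict; apply: pF.
- by move=> -[y Wy] /=; apply: (proj1 (HF y) Wy).
- by exists (exist _ x Zx).
Qed.

Lemma chain_has_indep Z c m : is_chain Z c m -> has_indep Z m.
Proof.
move=> [ic sc]; suff H i : (i <= m)%N -> has_indep (c i) i.
  by apply: has_indep_sub (H m _) => //; case: (ic m (leqnn m)).
elim: i => [_|i IHi im].
  exists (fun _ _ => 0); split=> [i|p vp]; first exact: pf_const.
  have [[_ [[x c0x] _]] _] := ic 0%N (leq0n m).
  exact: (vp (exist _ x c0x)).
have [[icS _] [ici _]] := (ic _ im, ic _ (ltnW im)); have [sub ex] := sc _ im.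
by apply: has_indep_lt sub ex _ => //; apply: IHi; apply: ltnW.
Qed.

Lemma zclosed_common_zeros (P : itp k n -> Prop) :
  zclosed (fun x => forall Q, P Q -> ev n (rc^~ x) Q = 0).
Proof.
exists (fun f => exists Q, P Q /\ f = fun x => ev n (rc^~ x) Q); split.
  by move=> _ [Q [_ ->]]; apply: polyfn_rc_ev.
move=> x; split=> [Wx _ [Q [PQ ->]]|Wx Q PQ]; first exact: Wx.
by apply: (Wx (fun x => ev n (rc^~ x) Q)); exists Q.
Qed.

(** [W] is the zero set of a prime that contains the ideal of the slice [V m = c0] and contains no
    nonzero polynomial in the first [m] functions. The openness of the image of [V] ensures that the
    ideal of the slice itself contains none. *)
Lemma irred_drop Z m : irred_closed Z -> has_indep Z m.+1 ->
  exists W, [/\ irred_closed W, subsetA W Z, exists x, Z x /\ ~ W x & has_indep W m].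
Proof.
move=> iZ [V [pV iV]]; have irrZ := irred_param iZ.
have [a [a0 Ha]] := dominant_open n irrZ (fun i => polyfn_restrict Z (pV i))
  (fun i => polyfn_restrict Z (polyfn_rc i)) iV.
have lift_point p : ev m.+1 p a != 0 ->
    exists x, Z x /\ forall i, (i < m.+1)%N -> V i x = p i.
  move=> /Ha [xi Hxi]; exists (pt_row xi).
  have sval_row (t : pts Z) : pt_row ((fun i (t : pts Z) => rc i (sval t))^~ t) = sval t.
    by apply/rowP => i; rewrite mxE rcE.
  split=> [|i im].
    case: iZ => [[F [pF HF]] _]; apply/HF => f Ff.
    apply: (Hxi _ (polyfn_pt_row m.+1 (pF _ Ff))) => t /=; rewrite sval_row.
    exact: (proj1 (HF _) (svalP t)).
  (* [V i] minus the i-th parameter vanishes on all pairs coming from points of [Z], hence at (p,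
     xi). *)
  apply/eqP; rewrite -subr_eq0 -mulN1r; apply/eqP.
  pose mi := pf_mul (pf_const _ (-1))
    (pf_coord (prod_coord (@npt_coord k m.+1) (@npt_coord k n)) (inl (Ordinal im))).
  apply: (Hxi _ (pf_add (polyfn_pt_row m.+1 (pV i)) mi)) => t.
  by rewrite sval_row /= mulN1r subrr.
have [p0 p0a] := ev_neq0 a0; pose c0 := p0 m.
(* [ac] is [a] with its last variable set to [c0]; it is nonzero because [c0] comes from a point
   where [a] is nonzero. *)
have [ac Hac] : exists ac : itp k m, forall p, ev m.+1 (upd p m c0) a = ev m p ac.
  apply: polyfn_npt; apply: (@polyfn_ev _ _ _ _ (fun i p => upd p m c0 i)) => i.
  rewrite ltnS leq_eqVlt => im; case: (eqVneq i m) im => [-> _|ne /= im].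
    by apply: polyfn_ext (pf_const _ c0) => p; rewrite /upd eqxx.
  apply: polyfn_ext (pf_coord (@npt_coord k m) (Ordinal im)) => p.
  by rewrite /upd (negbTE ne).
have ac0 : ac != 0.
  apply/eqP => ac0; move/negP: p0a; apply; apply/eqP.
  have := Hac p0; rewrite ac0 rmorph0 => <-; apply: eq_ev => i _.
  by rewrite /upd; case: eqP => [->|].
have slice (q : itp k m) : q != 0 ->
    exists x, [/\ Z x, V m x = c0 & ev m (V^~ x) q != 0].
  move=> q0; have [p] := ev_neq0 (mulf_neq0 q0 ac0).
  rewrite rmorphM mulf_eq0 negb_or -Hac => /andP [pq /lift_point [x [Zx Hx]]].
  exists x; split=> //; first by rewrite Hx // /upd eqxx.
  congr (_ != 0) : pq; apply: eq_ev => i im.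
  by rewrite (Hx _ (ltnW (im : (i.+1 < m.+1)%N))) /upd ltn_eqF.
pose I0 (P : itp k n) := forall x, Z x -> V m x = c0 -> ev n (rc^~ x) P = 0.
pose S (P : itp k n) := exists q : itp k m, q != 0 /\
  forall x, ev n (rc^~ x) P = ev m (V^~ x) q.
have idI0 : is_ideal I0.
  split; first by move=> x _ _; rewrite rmorph0.
    by move=> P Q IP IQ x Zx Vx; rewrite rmorphD IP // IQ // addr0.
  by move=> c P IP x Zx Vx; rewrite rmorphM IP // mulr0.
have [||Q IQ [q [q0 Hq]]|P [prP I0P PS]] := @prime_avoiding _ I0 S idI0.
- by exists 1; split; [apply: oner_neq0|move=> x; rewrite !rmorph1].
- move=> P Q [p [pn0 Hp]] [q [q0 Hq]]; exists (p * q); split; first exact: mulf_neq0.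
  by move=> x; rewrite !rmorphM Hp Hq.
- by have [x [Zx Vx]] := slice q q0; rewrite -Hq IQ ?eqxx.
pose W x := forall Q, P Q -> ev n (rc^~ x) Q = 0.
(* By the Nullstellensatz, [P] is the whole ideal of [W]; this gives nonemptiness, irreducibility
   and independence on [W]. *)
have WP Q : (forall x, W x -> ev n (rc^~ x) Q = 0) -> P Q.
  move=> WQ; apply: contrapT => nPQ.
  have [p [Hp /eqP []]] := prime_has_zero prP nPQ.
  by rewrite -rc_pt_row; apply: WQ => Q' PQ'; rewrite rc_pt_row; apply: Hp.
have cW : zclosed W by apply: zclosed_common_zeros.
have VmW x : W x -> V m x = c0.
  move=> Wx; have [Q HQ] := polyfnA (pf_add (pV m) (pf_const _ (- c0))).
  have : ev n (rc^~ x) Q = 0.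
    by apply: Wx; apply: I0P => y Zy Vy; rewrite -HQ Vy subrr.
  by rewrite -HQ => /eqP; rewrite subr_eq0 => /eqP.
exists W; split.
- apply: param_irred => //; split.
    have [_ P1 _] := prP; have [x Wx] : exists x, W x.
      by apply: contrapT => no; apply/P1/WP => x Wx; case: no; exists x.
    by exists; exists x.
  move=> f g /polyfn_lift [F [/polyfnA [QF HF] HfF]] /polyfn_lift [G [/polyfnA [QG HG] HgG]] fg.
  have : P (QF * QG).
    apply: WP => x Wx; have := fg (exist _ x Wx).
    by rewrite HfF HgG /= HF HG rmorphM.
  case: prP => _ _ pP /pP [PQ|PQ]; [left|right] => -[x Wx].
    by rewrite HfF HF; apply: Wx.
  by rewrite HgG HG; apply: Wx.
- move=> x Wx; case: iZ => [[F [pF HF]] _]; apply/HF => f Ff.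
  have [Q HQ] := polyfnA (pF _ Ff); rewrite HQ; apply: Wx; apply: I0P => y Zy _.
  by rewrite -HQ; apply: (proj1 (HF y) Zy).
(* If [W] were all of [Z], then [V m - c0] would vanish on [Z], a relation among the [m.+1]
   functions. *)
- apply: contrapT => no.
  have [C HC] := ev_const m c0.
  have := iV ('X - C%:P : {poly itp k m}); move=> /(_ _)/eqP.
  rewrite polyXsubC_eq0 => H; suff // : false by []; apply: H => -[x Zx].
  rewrite evSB evX evC HC /=; apply/eqP; rewrite subr_eq0; apply/eqP; apply: VmW.
  by apply: contrapT => nWx; apply: no; exists x.
exists V; split=> // q vq; apply/eqP; apply: contraT => q0.
have [Q HQ] : exists Q : itp k n, forall x, ev m (V^~ x) q = ev n (rc^~ x) Q.
  by apply: polyfnA; apply: polyfn_ev => i _.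
have PQ : P Q by apply: WP => x Wx; rewrite -HQ; apply: (vq (exist _ x Wx)).
by case: (PS _ PQ); exists q; split=> // x; rewrite HQ.
Qed.

Lemma chain_exists Z m : irred_closed Z -> has_indep Z m -> exists c, is_chain Z c m.
Proof.
elim: m Z => [|m IHm] Z iZ hZ; first by exists (fun=> Z); split=> i // _; split.
have [W [iW WZ [x [Zx nWx]] hW]] := irred_drop iZ hZ.
have [c [ic sc]] := IHm W iW hW.
exists (fun i => if (i <= m)%N then c i else Z); split=> i im.
  case: ifP => [im'|_]; last by split.
  by have [? cW] := ic i im'; split=> // y cy; apply/WZ/cW.
move: im; rewrite ltnS => im; rewrite im; case: ifP => [im'|im']; first exact: sc.
have <- : m = i by apply/eqP; rewrite eqn_leq im leqNgt im'.
have [_ cW] := ic m (leqnn m); split; first by move=> y cy; apply/WZ/cW.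
by exists x; split=> // cx; apply/nWx/cW.
Qed.

Lemma has_dim_indep Z m : irred_closed Z -> has_indep Z m -> ~ has_indep Z m.+1 -> has_dim Z m.
Proof.
move=> iZ hm nhm; split; first exact: chain_exists.
move=> c m' /chain_has_indep hm'; rewrite leqNgt; apply/negP => mm'.
by apply: nhm; apply: has_indep_leq hm'.
Qed.

Lemma has_dim_unique Z d e : has_dim Z d -> has_dim Z e -> d = e.
Proof.
by move=> [[c Hc] Hd] [[c' Hc'] He]; apply/eqP; rewrite eqn_leq (Hd _ _ Hc') (He _ _ Hc).
Qed.

(** Select each coordinate that is not algebraic over the earlier ones. The selected ones are
    independent, and the growth bound excludes any larger independent family, so their number is the
    dimension. *)
Lemma transcendence_coordinates Z d : irred_closed Z -> has_dim Z d ->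
  exists tau : pred nat,
    [/\ count tau (iota 0 n) = d,
        forall i, (i < n)%N -> ~~ tau i -> algebraic (fun i (t : pts Z) => rc i (sval t)) i &
        indep d (fun l (t : pts Z) => rc (nth 0%N (filter tau (iota 0 n)) l) (sval t))].
Proof.
move=> iZ dZ; have irrZ := irred_param iZ; set w := fun i (t : pts Z) => rc i (sval t).
pose tau i := ~~ `[< algebraic w i >].
have pw i : polyfn (@crdZ Z) (w i) by apply: polyfn_restrict; apply: polyfn_rc.
have alg i : (i < n)%N -> ~~ tau i -> algebraic w i by move=> _ /negPn /asboolP.
have ntr i : (i < n)%N -> tau i -> ~ algebraic w i by move=> _ /asboolPn.
have prw := vanish_prime irrZ pw.
have ind := indep_transcendental (proj1 irrZ) ntr.
have gr := growth_count prw alg.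
have dE : count tau (iota 0 n) = d.
  apply: has_dim_unique dZ; apply: has_dim_indep => //.
    exists (fun l => rc (nth 0%N (filter tau (iota 0 n)) l)); split=> // i.
    exact: polyfn_rc.
  move=> [V [pV iV]]; apply: (growth_dependent prw gr _ iV) => i.
  by have [p Hp] := polyfnA (pV i); exists p => t; rewrite Hp.
by exists tau; split=> //; rewrite -dE.
Qed.

End Dimension.

(** * Closures of images of irreducible parameter spaces *)

Section Closure.
Local Open Scope ring_scope.
Variables (k : closedFieldType) (n : nat).

Lemma polyfn_prod (T I J : Type) (crd : I -> T -> k) (r : seq J) (F : J -> T -> k) :
  (forall j, polyfn crd (F j)) -> polyfn crd (fun t => \prod_(j <- r) F j t).
Proof.
move=> pF; elim: r => [|j r IHr].
  by apply: polyfn_ext (pf_const crd 1) => t; rewrite big_nil.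
by apply: polyfn_ext (pf_mul (pF j) IHr) => t; rewrite big_cons.
Qed.

Lemma polyfn_det (T I : Type) (crd : I -> T -> k) (A : T -> 'M[k]_n) :
  (forall i j, polyfn crd (fun t => A t i j)) -> polyfn crd (fun t => \det (A t)).
Proof.
move=> pA; apply: polyfn_sum => s; apply: pf_mul; first exact: pf_const.
by apply: polyfn_prod => i.
Qed.

Lemma polyfn_rows (T I : Type) (crd : I -> T -> k) (x : T -> 'rV[k]_n) f :
  (forall i, polyfn crd (fun t => x t 0 i)) -> polyfn (@coordA k n) f ->
  polyfn crd (fun t => f (x t)).
Proof. by move=> px /(polyfn_comp x); apply: polyfn_trans. Qed.

Lemma polyfn_aff (T I : Type) (crd : I -> T -> k) (g : T -> 'M[k]_n * 'rV[k]_n)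
    (x y : T -> 'rV[k]_n) :
  (forall c, polyfn crd (fun t => coordAff c (g t))) ->
  (forall i, polyfn crd (fun t => x t 0 i)) -> (forall i, polyfn crd (fun t => y t 0 i)) ->
  forall i, polyfn crd (fun t => (aff_act (g t) (x t) + y t) 0 i).
Proof.
move=> pg px py i.
have pxA : polyfn crd (fun t => \sum_j x t 0 j * (g t).1 j i).
  by apply: polyfn_sum => j; apply: pf_mul => //; apply: (pg (inl (j, i))).
apply: polyfn_ext (pf_add (pf_add pxA (pg (inr i))) (py i)) => t.
by rewrite /aff_act !mxE.
Qed.

Lemma zclosed_zclosure (S : 'rV[k]_n -> Prop) : zclosed (zclosure S).
Proof.
exists (fun f => polyfn (@coordA k n) f /\ forall x, S x -> f x = 0).
split=> [f []//|x]; split=> [Sx f [pf Sf]|Sx C [F [pF HF]] SC].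
  exact: (Sx _ (zclosed_zero pf) Sf).
apply/HF => f Ff; apply: Sx; split; first exact: pF.
by move=> y /SC /HF; apply.
Qed.

Variables (T I : Type) (crd : I -> T -> k) (phi : T -> 'rV[k]_n).
Hypotheses (irr_pair : irr_param crd) (pphi : forall i, polyfn crd (fun t => phi t 0 i)).

Definition image_closure := zclosure (fun z => exists t, z = phi t).

Lemma image_closure_mem t : image_closure (phi t).
Proof. by move=> C _; apply; exists t. Qed.

Lemma image_closure_vanish f : polyfn (@coordA k n) f -> (forall t, f (phi t) = 0) ->
  forall x, image_closure x -> f x = 0.
Proof.
by move=> pf f0 x Zx; apply: (Zx _ (zclosed_zero pf)) => _ [t ->].
Qed.

Lemma irred_image_closure : irred_closed image_closure.
Proof.
apply: param_irred; first exact: zclosed_zclosure.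
case: irr_pair => [[t0] irr]; split; first by exists; exists (phi t0); apply: image_closure_mem.
move=> f g /polyfn_lift [F [pF HF]] /polyfn_lift [G [pG HG]] fg.
have [|F0|G0] := irr _ _ (polyfn_rows pphi pF) (polyfn_rows pphi pG).
- by move=> t; have := fg (exist _ _ (image_closure_mem t)); rewrite HF HG.
- by left=> -[x Zx]; rewrite HF /=; apply: (image_closure_vanish pF).
- by right=> -[x Zx]; rewrite HG /=; apply: (image_closure_vanish pG).
Qed.

(** A polynomial relation is itself a polynomial function, so it holds on the closure as soon as it
    holds on the image. *)
Lemma has_indep_image_closure m : has_indep image_closure m <->
  exists V : nat -> 'rV[k]_n -> k,
    (forall i, polyfn (@coordA k n) (V i)) /\ indep m (fun i t => V i (phi t)).
Proof.
split=> -[V [pV iV]]; exists V; split=> // p vp; apply: iV => t.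
  case: t => x Zx; have pf : polyfn (@coordA k n) (fun x => ev m (V^~ x) p).
    by apply: polyfn_ev.
  exact: (image_closure_vanish pf).
exact: (vp (exist _ _ (image_closure_mem t))).
Qed.

End Closure.

(** * The bound by the ambient dimension, and transport of algebraicity *)

Section Ambient.
Local Open Scope ring_scope.
Variables (k : closedFieldType) (n : nat).

Lemma has_indep_ambient (Z : 'rV[k]_n -> Prop) : irred_closed Z -> ~ has_indep Z n.+1.
Proof.
move=> iZ [V [pV iV]]; have irrZ := irred_param iZ.
pose w i (t : pts Z) := rc i (sval t).
have pw i : polyfn (@crdZ k n Z) (w i) by apply: polyfn_restrict; apply: polyfn_rc.
have prw := vanish_prime irrZ pw.
have gr : growth w n n.
  have := @growth_count k (pts Z) w predT n prw.
  by rewrite count_predT size_iota; apply.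
apply: (growth_dependent prw gr _ iV) => i.
by have [p Hp] := polyfnA (pV i); exists p => t; rewrite Hp.
Qed.

(** Algebraicity survives when [d] further functions are put in front; this serves to list the
    coordinates of X before those of Y. *)
Lemma algebraic_shift (T : Type) (w w' : nat -> T -> k) (d i : nat) :
  (forall j t, (j <= i)%N -> w (d + j)%N t = w' j t) -> algebraic w' i -> algebraic w (d + i).
Proof.
move=> ww' [P [vP nP]].
have /choice [q Hq] (j : nat) : exists q : itp k (d + i), forall a,
    ev i (fun l => a (d + l)%N) P`_j = ev (d + i) a q.
  apply: polyfn_npt; apply: (@polyfn_ev _ _ _ _ (fun l a => a (d + l)%N)) => l li.
  have lt : (d + l < d + i)%N by rewrite ltn_add2l.
  exact: (pf_coord (@npt_coord k (d + i)) (Ordinal lt)).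
have Hq' j t : ev (d + i) (w^~ t) (q j) = ev i (w'^~ t) P`_j.
  by rewrite -Hq; apply: eq_ev => l li; rewrite ww' // ltnW.
exists (\poly_(j < size P) q j); split.
  move=> t; apply: etrans (vP t); rewrite (@ev_wide k _ (size P)) ?size_poly //.
  rewrite (@ev_wide k _ (size P)) //; apply: eq_bigr => j _.
  by rewrite coef_poly ltn_ord Hq' ww'.
move=> vq; apply: nP => j t; rewrite -Hq'; have := vq j t.
rewrite coef_poly; case: ltnP => // szj _.
by rewrite Hq' nth_default // rmorph0.
Qed.

Lemma algebraic_comp (T S : Type) (s : S -> T) (r : T -> S) (w : nat -> T -> k) i :
  cancel r s -> algebraic w i -> algebraic (fun j x => w j (s x)) i.
Proof.
move=> rs [P [vP nP]]; exists P; split=> [t|vc]; first exact: (vP (s t)).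
by apply: nP => j t; have := vc j (r t); rewrite rs.
Qed.

Lemma count_iota_cat (tau1 tau2 : pred nat) (n1 n2 : nat) :
  count (fun i => if (i < n1)%N then tau1 i else tau2 (i - n1)%N) (iota 0 (n1 + n2)) =
  (count tau1 (iota 0 n1) + count tau2 (iota 0 n2))%N.
Proof.
rewrite iotaD count_cat add0n; congr (_ + _)%N.
  by apply: eq_in_count => i; rewrite mem_iota => /andP [_ ->].
rewrite -[X in iota X _]addn0 iotaDl count_map; apply: eq_count => i /=.
by rewrite ltnNge leq_addr /= addKn.
Qed.

End Ambient.

(** * The upper bound for the sum *)

Section Sum.
Local Open Scope ring_scope.
Variables (k : closedFieldType) (n : nat) (X Y : 'rV[k]_n -> Prop).
Hypotheses (iX : irred_closed X) (iY : irred_closed Y).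

Let T := (pts X * pts Y)%type.
Let crdT := prod_coord (@crdZ k n X) (@crdZ k n Y).

Definition sum_map (g : 'M[k]_n * 'rV[k]_n) (t : T) : 'rV[k]_n :=
  aff_act g (sval t.1) + sval t.2.

Lemma irr_pair : irr_param crdT.
Proof. by apply: irr_prod; apply: irred_param. Qed.

Lemma polyfnT1 f : polyfn (@coordA k n) f -> polyfn crdT (fun t => f (sval t.1)).
Proof. by apply: (@polyfn_rows k n _ _ crdT (fun t => sval t.1)) => i; apply: (pf_coord crdT (inl i)). Qed.

Lemma polyfnT2 f : polyfn (@coordA k n) f -> polyfn crdT (fun t => f (sval t.2)).
Proof. by apply: (@polyfn_rows k n _ _ crdT (fun t => sval t.2)) => i; apply: (pf_coord crdT (inr i)). Qed.

Lemma polyfn_sum_map g i : polyfn crdT (fun t => sum_map g t 0 i).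
Proof.
apply: (@polyfn_aff k n _ _ crdT (fun=> g) (fun t => sval t.1) (fun t => sval t.2)).
- by move=> c; apply: pf_const.
- by move=> j; apply: (pf_coord crdT (inl j)).
- by move=> j; apply: (pf_coord crdT (inr j)).
Qed.

Lemma mink_sum_image g : mink_sum (aff_image g X) Y = image_closure (sum_map g).
Proof.
rewrite /mink_sum /image_closure; congr zclosure; apply/funext => z; apply/propext.
split=> [[p [q [[x [Xx ->]] [Yq ->]]]]|[[[x Xx] [y Yy]] ->]].
  by exists (exist _ x Xx, exist _ q Yq).
by exists (aff_act g x), y; split=> //; exists x.
Qed.

Lemma sum_indep_bound g dX dY : has_dim X dX -> has_dim Y dY ->
  ~ has_indep (mink_sum (aff_image g X) Y) (dX + dY).+1.
Proof.
move=> hX hY; rewrite mink_sum_image => /has_indep_image_closure [V [pV iV]].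
have [tX [cX aX _]] := transcendence_coordinates iX hX.
have [tY [cY aY _]] := transcendence_coordinates iY hY.
(* The coordinates of X followed by those of Y; exactly dX + dY of them are selected by [tau], and
   the functions on the sum pull back to polynomials in them. *)
pose w i (t : T) := if (i < n)%N then rc i (sval t.1) else rc (i - n)%N (sval t.2).
have pw i : polyfn crdT (w i).
  by rewrite /w; case: (i < n)%N; [apply: polyfnT1|apply: polyfnT2]; apply: polyfn_rc.
have prw := vanish_prime irr_pair pw.
pose tau i := if (i < n)%N then tX i else tY (i - n)%N.
have [[[x0] _] [[y0] _]] := (irred_param iX, irred_param iY).
have alg i : (i < n + n)%N -> ~~ tau i -> algebraic w i.
  move=> nn; rewrite /tau; case: (ltnP i n) => ni nt.
    apply: (@algebraic_shift k T w (fun j t => rc j (sval t.1)) 0 i).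
      by move=> j t ji; rewrite add0n /w (leq_ltn_trans ji ni).
    exact: (algebraic_comp (s := fun t : T => t.1) (r := fun x => (x, y0)) _ (aX i ni nt)).
  rewrite -(subnKC ni); apply: (@algebraic_shift k T w (fun j t => rc j (sval t.2))).
    by move=> j t _; rewrite /w ltnNge leq_addr /= addKn.
  apply: (algebraic_comp (s := fun t : T => t.2) (r := fun y => (x0, y)) _ (aY _ _ nt)) => //.
  by rewrite ltn_subLR.
have := growth_count prw alg; rewrite count_iota_cat cX cY => gr.
apply: (growth_dependent prw gr _ iV) => i.
apply: (@ev_polyfn k T (n + n) w); apply: polyfn_trans (polyfn_rows (polyfn_sum_map g) (pV i)).
move=> [j|j].
  have lt : (j < n + n)%N by rewrite ltn_addr.
  apply: polyfn_ext (pf_coord (fun i : 'I_(n + n) => w i) (Ordinal lt)) => t.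
  by rewrite /w /= ltn_ord rcE.
have lt : (n + j < n + n)%N by rewrite ltn_add2l.
apply: polyfn_ext (pf_coord (fun i : 'I_(n + n) => w i) (Ordinal lt)) => t.
by rewrite /w /= ltnNge leq_addr /= addKn rcE.
Qed.

End Sum.

(** * Independent coordinates in a special position *)

Section SpecialPosition.
Local Open Scope ring_scope.
Variables (k : closedFieldType) (n : nat) (X Y : 'rV[k]_n -> Prop).

Lemma rc_add i (x y : 'rV[k]_n) : rc i (x + y) = rc i x + rc i y.
Proof. by rewrite /rc; case: insub => [j|]; rewrite ?mxE ?addr0. Qed.

(* The matrix sends the coordinate [s]_l to the coordinate [c]_l, for l < d. *)
Definition transfer_mx (s c : seq nat) (d : nat) : 'M[k]_n :=
  \matrix_(i, j) (((j : nat) \in take d c) && ((i : nat) == nth 0%N s (index (j : nat) c)))%:R.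

Lemma rc_transfer_mx s c d j x : (j < n)%N -> all (fun i => i < n)%N s -> (d <= size s)%N ->
  rc j (x *m transfer_mx s c d) = if j \in take d c then rc (nth 0%N s (index j c)) x else 0.
Proof.
move=> jn sn ds; rewrite (rcE (Ordinal jn)) mxE.
case: ifP => jc; last first.
  by rewrite big1 // => i _; rewrite mxE jc mulr0.
have idx : (index j c < d)%N.
  rewrite -[c](cat_take_drop d) index_cat jc; apply: (@leq_trans (size (take d c))).
    by rewrite index_mem.
  by rewrite size_take_min geq_minl.
have lt : (nth 0%N s (index j c) < n)%N by apply: (allP sn); rewrite mem_nth // (leq_trans idx).
rewrite (bigD1 (Ordinal lt)) //= mxE jc eqxx mulr1 big1 ?addr0; first by rewrite (rcE (Ordinal lt)).
move=> i ne; rewrite mxE jc /= (_ : (_ == _) = false) ?mulr0 //.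
by apply: contraNF ne => /eqP E; apply/eqP/val_inj.
Qed.

(** The first [dY] coordinates of the sum are the basis coordinates of y alone; each later one is a
    basis coordinate of x plus a coordinate of y. For fixed y the later ones are independent on X up
    to a translation, so [P] vanishes for arbitrary values in those slots; independence on Y then
    frees the first slots. *)
Lemma indep_special (sX sY cY : seq nat) (dX dY m : nat) :
  size sX = dX -> size sY = dY -> (dY <= m)%N -> (m <= dX + dY)%N -> (m <= size (sY ++ cY))%N ->
  uniq (sY ++ cY) -> all (fun i => i < n)%N sX -> all (fun i => i < n)%N (sY ++ cY) ->
  indep dX (fun l (t : pts X) => rc (nth 0%N sX l) (sval t)) ->
  indep dY (fun l (t : pts Y) => rc (nth 0%N sY l) (sval t)) ->
  indep m (fun l (t : pts X * pts Y) =>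
    rc (nth 0%N (sY ++ cY) l) (sum_map (transfer_mx sX cY (m - dY), 0) t)).
Proof.
move=> szX szY dYm mXY msz unq sXn sn iX iY P vP.
set K := nth 0%N (sY ++ cY).
have KY l : (l < dY)%N -> K l = nth 0%N sY l by rewrite /K nth_cat szY => ->.
have Kn l : (l < m)%N -> (K l < n)%N.
  by move=> lm; apply: (allP sn); rewrite mem_nth // (leq_trans lm).
have dX' : (m - dY <= size sX)%N by rewrite szX leq_subLR addnC.
have val_low l (t : pts X * pts Y) : (l < dY)%N ->
    rc (K l) (sum_map (transfer_mx sX cY (m - dY), 0) t) = rc (nth 0%N sY l) (sval t.2).
  move=> lY; rewrite /sum_map /aff_act addr0 rc_add rc_transfer_mx //; last first.
    by apply: Kn; apply: leq_trans lY _.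
  rewrite ifN ?add0r KY //; apply/negP => /mem_take lc.
  move: unq; rewrite cat_uniq => /and3P [_ /hasPn /(_ _ lc) + _].
  by rewrite /= mem_nth ?szY.
have val_high l (t : pts X * pts Y) : (dY <= l)%N -> (l < m)%N ->
    rc (K l) (sum_map (transfer_mx sX cY (m - dY), 0) t) =
    rc (nth 0%N sX (l - dY)) (sval t.1) + rc (K l) (sval t.2).
  move=> Yl lm; rewrite /sum_map /aff_act addr0 rc_add rc_transfer_mx //; last exact: Kn.
  have KE : K l = nth 0%N cY (l - dY) by rewrite /K nth_cat szY ltnNge Yl.
  have szc : (l - dY < size cY)%N by rewrite ltn_subLR // -szY -size_cat (leq_trans lm).
  have uc : uniq cY by move: unq; rewrite cat_uniq => /and3P [].
  rewrite KE index_uniq // ifT //.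
  have lt' : (l - dY < m - dY)%N by rewrite ltn_sub2r // (leq_ltn_trans Yl).
  by rewrite -(nth_take 0%N lt') mem_nth // size_take; case: ifP.
have step1 (y : pts Y) a :
    ev m (fun l => if (l < dY)%N then rc (nth 0%N sY l) (sval y) else a l) P = 0.
  have [q Hq] : exists q : itp k (m - dY), forall z : nat -> k,
      ev m (fun l => if (l < dY)%N then rc (nth 0%N sY l) (sval y)
                     else z (l - dY)%N + rc (K l) (sval y)) P = ev (m - dY) z q.
    apply: polyfn_npt.
    apply: (@polyfn_ev _ _ _ _ (fun l z => if (l < dY)%N then rc (nth 0%N sY l) (sval y)
                     else z (l - dY)%N + rc (K l) (sval y))) => l lm.
    case: ltnP => lY; first exact: pf_const.
    have lt : (l - dY < m - dY)%N by rewrite ltn_sub2r // (leq_ltn_trans lY).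
    exact: pf_add (pf_coord (@npt_coord k (m - dY)) (Ordinal lt)) (pf_const _ _).
  have q0 : q = 0.
    apply: (indep_leq dX' (m' := size sX)); first by rewrite szX; exact: iX.
    move=> x; rewrite -Hq -[RHS](vP (x, y)); apply: eq_ev => l lm.
    case: ltnP => lY; first by rewrite val_low.
    by rewrite val_high.
  (* The translation by the coordinates of y is undone, so the later slots take the prescribed
     values [a]. *)
  have := Hq (fun l => a (l + dY)%N - rc (K (l + dY)%N) (sval y)).
  rewrite q0 rmorph0 => <-; apply: eq_ev => l lm; case: ltnP => // lY.
  by rewrite subnK // subrK.
apply/eqP; apply: contraT => /ev_neq0 [a] /eqP [].
have [q Hq] : exists q : itp k dY, forall z : nat -> k,
    ev m (fun l => if (l < dY)%N then z l else a l) P = ev dY z q.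
  apply: polyfn_npt; apply: (@polyfn_ev _ _ _ _ (fun l z => if (l < dY)%N then z l else a l)) => l lm.
  case: ltnP => lY; last exact: pf_const.
  exact: (pf_coord (@npt_coord k dY) (Ordinal lY)).
have q0 : q = 0 by apply: iY => y; rewrite -Hq step1.
have := Hq a; rewrite q0 rmorph0 => <-; apply: eq_ev => l lm.
by case: ifP.
Qed.

End SpecialPosition.

(** * From one position to the general one *)

Section GeneralPosition.
Local Open Scope ring_scope.
Variables (k : closedFieldType) (n : nat).

Let C : finType := (('I_n * 'I_n) + 'I_n)%type.
Let N := #|C|.

Definition aff_of_pt (a : nat -> k) : 'M[k]_n * 'rV[k]_n :=
  (\matrix_(i, j) a (enum_rank (inl (i, j) : C)), \row_j a (enum_rank (inr j : C))).

Definition pt_of_aff (i : nat) (g : 'M[k]_n * 'rV[k]_n) : k :=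
  if insub i is Some j then coordAff (enum_val (j : 'I_N)) g else 0.

Lemma coord_aff_of_pt (c : C) a : coordAff c (aff_of_pt a) = a (enum_rank c).
Proof. by case: c => [[i j]|j]; rewrite /= mxE. Qed.

Lemma aff_of_ptK a i : (i < N)%N -> pt_of_aff i (aff_of_pt a) = a i.
Proof. by move=> iN; rewrite /pt_of_aff insubT coord_aff_of_pt enum_valK. Qed.

Lemma pt_of_affK g : aff_of_pt (pt_of_aff^~ g) = g.
Proof.
have E (c : C) : pt_of_aff (enum_rank c) g = coordAff c g.
  by rewrite /pt_of_aff valK enum_rankK.
case: g E => A b E; congr pair.
  by apply/matrixP => i j; rewrite mxE E.
by apply/rowP => j; rewrite mxE E.
Qed.

Lemma eq_aff_of_pt a b : (forall i, (i < N)%N -> a i = b i) -> aff_of_pt a = aff_of_pt b.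
Proof.
move=> ab; congr pair; first by apply/matrixP => i j; rewrite !mxE ab ?ltn_ord.
by apply/rowP => j; rewrite !mxE ab ?ltn_ord.
Qed.

Definition catn (d : nat) (a b : nat -> k) (i : nat) : k := if (i < d)%N then a i else b (i - d)%N.

Variables (X Y : 'rV[k]_n -> Prop).
Hypotheses (iX : irred_closed X) (iY : irred_closed Y).
Let T := (pts X * pts Y)%type.
Let crdT := prod_coord (@crdZ k n X) (@crdZ k n Y).

Lemma polyfn_sum_map_param (U J : Type) (crd : J -> U -> k) (a : U -> nat -> k)
    (t : U -> T) (i : nat) :
  (forall j, (j < N)%N -> polyfn crd (fun u => a u j)) ->
  (forall j, polyfn crd (fun u => crdZ j (t u).1)) ->
  (forall j, polyfn crd (fun u => crdZ j (t u).2)) ->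
  polyfn crd (fun u => rc i (sum_map (aff_of_pt (a u)) (t u))).
Proof.
move=> pa p1 p2; apply: (polyfn_rows (f := rc i)); last exact: polyfn_rc.
apply: (@polyfn_aff k n _ _ crd (fun u => aff_of_pt (a u)) (fun u => sval (t u).1)
         (fun u => sval (t u).2)) => // c.
apply: polyfn_ext (pa (enum_rank c) _) => [u|]; last exact: ltn_ord.
by rewrite coord_aff_of_pt.
Qed.

(** If [P] is nonzero at [p], join [g0] by a line to the affine map given by the first [N] entries
    of [p]. The functions are independent at parameter 0, so by [indep_adjoin] they are independent
    together with the parameter. Hence [P] vanishes along the whole line with arbitrary values of
    the other variables, in particular at [p], where the parameter is 1. *)
Lemma indep_total (K : nat -> nat) (m : nat) (g0 : 'M[k]_n * 'rV[k]_n) :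
  indep m (fun l (t : T) => rc (K l) (sum_map g0 t)) ->
  indep (N + m) (fun i (u : (nat -> k) * T) =>
    catn N u.1 (fun l => rc (K l) (sum_map (aff_of_pt u.1) u.2)) i).
Proof.
move=> ind0 P vP; have [[t0] _] := irr_pair iX iY; apply/eqP; apply: contraT => /ev_neq0 [p] /eqP [].
pose a0 i := pt_of_aff i g0.
pose line (s : k) i := a0 i + s * (p i - a0 i).
have [Q HQ] : exists Q : itp k m.+1, forall z : nat -> k,
    ev (N + m) (catn N (line (z m)) z) P = ev m.+1 z Q.
  apply: polyfn_npt; apply: (@polyfn_ev _ _ _ _ (fun i z => catn N (line (z m)) z i)) => i iNm.
  rewrite /catn; case: ltnP => iN.
    apply: pf_add (pf_const _ _) (pf_mul _ (pf_const _ _)).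
    exact: (pf_coord (@npt_coord k m.+1) ord_max).
  have lt : (i - N < m.+1)%N by rewrite ltn_subLR // addnS ltnS ltnW.
  exact: (pf_coord (@npt_coord k m.+1) (Ordinal lt)).
pose crd2 := prod_coord (@npt_coord k 1) crdT.
pose v l (u : (nat -> k) * T) := rc (K l) (sum_map (aff_of_pt (line (u.1 0%N))) u.2).
have Q0 : Q = 0.
  apply: (@indep_adjoin k _ T _ crd2 (fun t => (fun=> 0, t)) m v (fun u => u.1 0%N)).
  - by apply: irr_prod (irr_affine k 1) (irr_pair iX iY).
  - move=> l; apply: (@polyfn_sum_map_param _ _ crd2 (fun u => line (u.1 0%N)) (fun u => u.2)).
    + move=> j _; apply: pf_add (pf_const _ _) (pf_mul _ (pf_const _ _)).
      exact: (pf_coord crd2 (inl ord0)).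
    + by move=> j; exact: (pf_coord crd2 (inr (inl j))).
    + by move=> j; exact: (pf_coord crd2 (inr (inr j))).
  - exact: (pf_coord crd2 (inl ord0)).
  - apply: indep_ext ind0 => l t _; rewrite /v /= -[g0 in LHS]pt_of_affK.
    by congr (rc _ (sum_map _ _)); apply: eq_aff_of_pt => i _; rewrite /line mul0r addr0.
  - by [].
  - by exists (fun=> 1, t0); apply/eqP; apply: oner_neq0.
  move=> u; rewrite -HQ eqxx -[RHS](vP (line (u.1 0%N), u.2)).
  apply: eq_ev => i iNm; rewrite /catn; case: ltnP => // iN.
  by rewrite ltn_eqF // ltn_subLR.
have := HQ (upd (fun l => p (N + l)%N) m 1); rewrite Q0 rmorph0 => <-.
apply: eq_ev => i iNm; rewrite /catn; case: ltnP => iN.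
  by rewrite /line /upd eqxx mul1r addrC subrK.
by rewrite /upd ltn_eqF ?ltn_subLR // subnKC.
Qed.

(** The map (g, t) to (g, values at t) is dominant, so its image contains the set where some nonzero
    [a] does not vanish. Whenever this set has points over g, the values over g fill a nonempty open
    set and satisfy no relation. *)
Lemma general_indep (K : nat -> nat) (m : nat) (g0 : 'M[k]_n * 'rV[k]_n) :
  indep m (fun l (t : T) => rc (K l) (sum_map g0 t)) ->
  general_aff (fun g => indep m (fun l (t : T) => rc (K l) (sum_map g t))).
Proof.
move/indep_total => ind; pose crd3 := prod_coord (@npt_coord k N) crdT.
have irr3 : irr_param crd3 by apply: irr_prod (irr_affine k N) (irr_pair iX iY).
set v := (fun i (u : (nat -> k) * T) => _) in ind.
pose v' i := if (i < N + m)%N then v i else fun=> 0.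
have ind' : indep (N + m) v' by apply: indep_ext ind => i u iNm; rewrite /v' iNm.
have pv i : polyfn crd3 (v' i).
  rewrite /v'; case: ltnP => _; last exact: pf_const.
  rewrite /v /catn; case: ltnP => iN; first exact: (pf_coord crd3 (inl (Ordinal iN))).
  apply: (@polyfn_sum_map_param _ _ crd3 (fun u => u.1) (fun u => u.2)).
  - by move=> j jN; exact: (pf_coord crd3 (inl (Ordinal jN))).
  - by move=> j; exact: (pf_coord crd3 (inr (inl j))).
  - by move=> j; exact: (pf_coord crd3 (inr (inr j))).
(* The coordinates of both points are carried along, so that a point of X and one of Y can be
   recovered from [xi]. *)
pose x i (u : (nat -> k) * T) := if (i < n)%N then rc i (sval u.2.1) else rc (i - n)%N (sval u.2.2).
have px i : polyfn crd3 (x i).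
  rewrite /x; case: (i < n)%N.
    apply: (@polyfn_rows k n _ _ crd3 (fun u => sval u.2.1)); last exact: polyfn_rc.
    by move=> j; exact: (pf_coord crd3 (inr (inl j))).
  apply: (@polyfn_rows k n _ _ crd3 (fun u => sval u.2.2)); last exact: polyfn_rc.
  by move=> j; exact: (pf_coord crd3 (inr (inr j))).
have [a [a0 Ha]] := dominant_open (n + n) irr3 pv px ind'.
have lift_point p : ev (N + m) p a != 0 -> exists t : T,
    forall l, (l < m)%N -> rc (K l) (sum_map (aff_of_pt p) t) = p (N + l)%N.
  move=> /Ha [xi Hxi]; set crd4 := prod_coord _ _ in Hxi.
  pose x1 (b : (nat -> k) * (nat -> k)) : 'rV[k]_n := \row_i b.2 i.
  pose x2 (b : (nat -> k) * (nat -> k)) : 'rV[k]_n := \row_i b.2 (n + i)%N.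
  have px1 i : polyfn crd4 (fun b => x1 b 0 i).
    have lt : (i < n + n)%N by rewrite ltn_addr.
    by apply: polyfn_ext (pf_coord crd4 (inr (Ordinal lt))) => b; rewrite mxE.
  have px2 i : polyfn crd4 (fun b => x2 b 0 i).
    have lt : (n + i < n + n)%N by rewrite ltn_add2l.
    by apply: polyfn_ext (pf_coord crd4 (inr (Ordinal lt))) => b; rewrite mxE.
  have x1E u : x1 (v'^~ u, x^~ u) = sval u.2.1.
    by apply/rowP => i; rewrite mxE /= /x ltn_ord rcE.
  have x2E u : x2 (v'^~ u, x^~ u) = sval u.2.2.
    by apply/rowP => i; rewrite mxE /= /x ltnNge leq_addr /= addKn rcE.
  have Xx : X (x1 (p, xi)).
    case: iX => [[F [pF HF]] _]; apply/HF => f Ff.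
    apply: (Hxi _ (polyfn_rows px1 (pF _ Ff))) => u; rewrite x1E.
    exact: (proj1 (HF _) (svalP u.2.1)).
  have Yx : Y (x2 (p, xi)).
    case: iY => [[F [pF HF]] _]; apply/HF => f Ff.
    apply: (Hxi _ (polyfn_rows px2 (pF _ Ff))) => u; rewrite x2E.
    exact: (proj1 (HF _) (svalP u.2.2)).
  exists (exist _ _ Xx, exist _ _ Yx) => l lm; rewrite /sum_map /=.
  have lt : (N + l < N + m)%N by rewrite ltn_add2l.
  have pw : polyfn crd4 (fun b => rc (K l) (aff_act (aff_of_pt b.1) (x1 b) + x2 b)).
    apply: (polyfn_rows (f := rc (K l))); last exact: polyfn_rc.
    apply: (@polyfn_aff k n _ _ crd4 (fun b => aff_of_pt b.1)) => // c.
    have ltc : (enum_rank (c : C) < N + m)%N by rewrite ltn_addr.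
    apply: polyfn_ext (pf_coord crd4 (inl (Ordinal ltc))) => b.
    by rewrite coord_aff_of_pt.
  apply/eqP; rewrite -subr_eq0 -mulN1r; apply/eqP.
  apply: (Hxi _ (pf_add pw (pf_mul (pf_const _ (-1)) (pf_coord crd4 (inl (Ordinal lt)))))).
  move=> u; rewrite x1E x2E /= /npt_coord /= mulN1r; apply/eqP; rewrite subr_eq0; apply/eqP.
  rewrite /v' lt /v /catn ltnNge leq_addr /= addKn; congr (rc _ _).
  rewrite /sum_map; congr (aff_act _ _ + _); apply: eq_aff_of_pt => i iN.
  by rewrite (ltn_addr _ iN) iN.
(* The equations are g |-> a (g, z) for all z; they vanish together at g exactly when the open set
   has no point over g. *)
exists (fun f => exists z, f = fun g => ev (N + m) (catn N (pt_of_aff^~ g) z) a).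
split.
  move=> _ [z ->]; apply: (@polyfn_ev _ _ _ _ (fun i g => catn N (pt_of_aff^~ g) z i)) => i _.
  rewrite /catn; case: (i < N)%N; last exact: pf_const.
  rewrite /pt_of_aff; case: insub => [j|]; last exact: pf_const.
  exact: (pf_coord (@coordAff k n)).
split.
  (* A point where [a] and the determinant are both nonzero gives an invertible element of the open
     set. *)
  have [D HD] : exists D : itp k (N + m), forall b, \det (aff_of_pt b).1 = ev (N + m) b D.
    apply: polyfn_npt; apply: (@polyfn_det k n _ _ _ (fun b => (aff_of_pt b).1)) => i j.
    have lt : (enum_rank (inl (i, j) : C) < N + m)%N by rewrite ltn_addr.
    by apply: polyfn_ext (pf_coord (@npt_coord k (N + m)) (Ordinal lt)) => b; rewrite mxE.
  have D0 : D != 0.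
    apply/eqP => D0; have := HD (pt_of_aff^~ (1%:M, 0)).
    by rewrite pt_of_affK det1 D0 rmorph0 => /eqP; rewrite oner_eq0.
  have [p] := ev_neq0 (mulf_neq0 a0 D0); rewrite rmorphM mulf_eq0 negb_or => /andP [pa pD].
  exists (aff_of_pt p); split; first by rewrite unitmxE unitfE HD.
  move=> H; move/negP: pa; apply; apply/eqP.
  have <- := H _ (ex_intro _ (fun l => p (N + l)%N) erefl).
  apply: eq_ev => i _; rewrite /catn; case: ltnP => iN; first by rewrite aff_of_ptK.
  by rewrite subnKC.
move=> g _ nz q vq; apply/eqP; apply: contraT => q0.
have [z0 Hz0] : exists z, ev (N + m) (catn N (pt_of_aff^~ g) z) a != 0.
  apply: contrapT => no; apply: nz => _ [z ->]; apply: contrapT => /eqP nz.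
  by apply: no; exists z.
have [ag Hag] : exists ag : itp k m, forall z,
    ev (N + m) (catn N (pt_of_aff^~ g) z) a = ev m z ag.
  apply: polyfn_npt; apply: (@polyfn_ev _ _ _ _ (fun i z => catn N (pt_of_aff^~ g) z i)) => i iNm.
  rewrite /catn; case: ltnP => iN; first exact: pf_const.
  have lt : (i - N < m)%N by rewrite ltn_subLR.
  exact: (pf_coord (@npt_coord k m) (Ordinal lt)).
have ag0 : ag != 0 by apply: contraNneq Hz0 => ag0; rewrite Hag ag0 rmorph0.
(* Take z with both [q] and a (g, z) nonzero: z is then the tuple of values at some point of X x Y,
   where [q] should vanish. *)
have [z] := ev_neq0 (mulf_neq0 q0 ag0).
rewrite rmorphM mulf_eq0 negb_or -Hag => /andP [/eqP qz /lift_point [t Ht]].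
case: qz; rewrite -(vq t); apply: eq_ev => l lm; have := Ht l lm.
rewrite {2}/catn ltnNge leq_addr /= addKn => <-; congr (rc _ (sum_map _ _)).
by rewrite -[RHS]pt_of_affK; apply: eq_aff_of_pt => i iN; rewrite /catn iN.
Qed.

End GeneralPosition.

(** * The dimension of the sum in general position *)

Theorem theorem3p9 (k : closedFieldType) (n : nat) (X Y : 'rV[k]_n -> Prop) (dX dY : nat) :
  variety X -> variety Y -> has_dim X dX -> has_dim Y dY ->
  general_aff (fun g => has_dim (mink_sum (aff_image g X) Y) (minn (dX + dY) n)).
Proof.
move=> iX iY hX hY; set m := minn (dX + dY) n.
have [tX [cX _ indX]] := transcendence_coordinates iX hX.
have [tY [cY _ indY]] := transcendence_coordinates iY hY.
set sX := filter tX (iota 0 n) in indX; set sY := filter tY (iota 0 n) in indY.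
(* The coordinates of Y outside its basis receive basis coordinates of X; [m - dY] of them suffice
   to reach [m] in total. *)
pose sC := filter (predC tY) (iota 0 n).
have pm : perm_eq (sY ++ sC) (iota 0 n) by rewrite perm_filterC.
have szX : size sX = dX by rewrite size_filter.
have szY : size sY = dY by rewrite size_filter.
have szYC : size (sY ++ sC) = n by rewrite (perm_size pm) size_iota.
have dYn : dY <= n by rewrite -szYC size_cat szY leq_addr.
have ind0 : indep m (fun l (t : pts X * pts Y) =>
    rc (nth 0 (sY ++ sC) l) (sum_map (transfer_mx k n sX sC (m - dY), 0%R) t)).
  apply: (indep_special szX szY) => //.
  - by rewrite leq_min leq_addl.
  - exact: geq_minl.
  - by rewrite szYC geq_minr.
  - by rewrite (perm_uniq pm) iota_uniq.
  - by apply/allP => i; rewrite mem_filter mem_iota => /andP [_ /andP []].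
  - by apply/allP => i; rewrite (perm_mem pm) mem_iota => /andP [].
have [F [pF [ne HF]]] := general_indep iX iY ind0.
exists F; split=> //; split=> // g ug ng.
have iZ : irred_closed (mink_sum (aff_image g X) Y).
  rewrite mink_sum_image; apply: irred_image_closure (irr_pair iX iY) _.
  exact: polyfn_sum_map.
apply: has_dim_indep => //.
  rewrite mink_sum_image; apply/has_indep_image_closure.
  exists (fun l => rc (nth 0 (sY ++ sC) l)); split; first by move=> l; apply: polyfn_rc.
  exact: HF.
(* A further independent function would contradict the bound dX + dY or the bound n, whichever is
   the minimum. *)
rewrite /m; case: leqP => _; first exact: (sum_indep_bound iX iY hX hY).
exact: has_indep_ambient.
Qed.
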